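(* Let $\theta\in(0,\infty)$ and let $b$ be a smooth function on $\mathbb{R}^3$, homogeneous of degree $\theta^{-1}$ (i.e. $b(\lambda\eta)=\lambda^{1/\theta}b(\eta)$ for $\lambda>0$), with $e^{-b}\in L^1(\mathbb{R}^3)$ and such that $\varphi:=\mathcal{F}^{-1}(e^{-b(\cdot)})\ge 0$, where $(\mathcal{F}^{-1}\psi)(p)=(2\pi)^{-3}\int_{\mathbb{R}^3}\psi(\eta)e^{ip\cdot\eta}\,d\eta$. Assume that $F=F(t,m)$ is a self-similar solution of the Smoluchowski coagulation equation with coagulation kernel $a(m,m')$, $$\partial_t F(t,m)=\frac12\int_0^m F(t,m-m')F(t,m')\,a(m-m',m')\,dm'-\int_0^\infty F(t,m)F(t,m')\,a(m,m')\,dm'.$$ Then the function $$f(t,m,p)=m^{-3\theta}\,F(t,m)\,\varphi\!\left(\frac{p}{m^\theta}\right),\qquad m>0,\ p\in\mathbb{R}^3,$$ is a self-similar solution of the ballistic aggregation equation $$\partial_t f(t,m,p)=\frac12\int_{\mathbb{R}^3}\int_0^m a(m',m-m')f(t,m',p')f(t,m-m',p-p')\,dm'dp'-\int_{\mathbb{R}^3}\int_0^\infty a(m,m')f(t,m,p)f(t,m',p')\,dm'dp'.$$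
   Context: $a(m,m')\ge 0$ is a given symmetric kernel on $(0,\infty)^2$, unrelated to the function $b$. Solutions $F\ge0$ (resp. $f\ge 0$) are functions for which the integrals in the equation are finite and the equation holds pointwise. A solution $F$ of the coagulation equation is self-similar if $F(t,m)=\nu(t)\,\Phi(\mu(t)\,m)$ for some profile $\Phi$ and some positive functions $\nu(t),\mu(t)$ of time. A solution $f(t,m,p)$ of the ballistic aggregation equation is self-similar if $f(t,m,p)=\lambda(t)\,\Psi(\mu_1(t)\,m,\mu_2(t)\,p)$ for some profile $\Psi$ and some positive functions $\lambda,\mu_1,\mu_2$ of time. *)

(* Defs.v *)
From HB Require Import structures.
From mathcomp Require Import all_boot all_order all_algebra.
From mathcomp Require Import all_classical all_reals all_analysis.
From mathcomp Require Import complex.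

Set Implicit Arguments.
Unset Strict Implicit.
Unset Printing Implicit Defensive.

Import Order.TTheory GRing.Theory Num.Theory.
Import numFieldNormedType.Exports.

Local Open Scope classical_set_scope.
Local Open Scope ring_scope.

(* R^3 is the product R * R * R: the product carries the vector space, normed
   and measurable structures of the library. *)
Notation vec3 R := (R * R * R)%type.
Notation leb := (@lebesgue_measure _).
Notation leb3 := ((leb \x leb) \x leb)%E.

Definition dot3 (R : realType) (p q : vec3 R) : R :=
  p.1.1 * q.1.1 + p.1.2 * q.1.2 + p.2 * q.2.

(* Smooth = C^oo: every iterated directional derivative is differentiable. *)
Definition smooth (R : realType) (V : normedModType R) (f : V -> R) : Prop :=
  forall (vs : seq V) (x : V),
    differentiable (foldr (fun v (g : V -> R) => 'D_v g) f vs) x.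

(* (2 pi)^-3 * the integral of psi(eta) e^{i p.eta}, for real-valued psi; the
   complex integral is taken componentwise. *)
Definition inv_fourier3 (R : realType) (psi : vec3 R -> R) (p : vec3 R)
  : R[i] :=
  let c := (2 * pi) ^- 3 in
  Complex (c * \int[leb3]_eta (psi eta * cos (dot3 p eta)))
          (c * \int[leb3]_eta (psi eta * sin (dot3 p eta))).

(* Time ranges over a set J, mass over (0, +oo); the values of F and f outside
   of these ranges are irrelevant. *)
Definition coagulation_solution (R : realType) (J : set R) (a : R -> R -> R)
    (F : R -> R -> R) : Prop :=
  (forall t m, J t -> 0 < m -> 0 <= F t m) /\
  forall t m, J t -> 0 < m ->
    let gain (m' : R) := F t (m - m') * F t m' * a (m - m') m' in
    let loss (m' : R) := F t m * F t m' * a m m' in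
    [/\ leb.-integrable `]0, m[ (EFin \o gain),
        leb.-integrable `]0, +oo[ (EFin \o loss)
      & is_derive t 1 (fun s => F s m)
          (2^-1 * (\int[leb]_(m' in `]0%R, m[) gain m')
           - \int[leb]_(m' in `]0%R, +oo[) loss m')].

(* Finiteness of the double integrals is integrability for the product measure
   in (p', m'); the equation is stated with the iterated integrals. *)
Definition ballistic_solution (R : realType) (J : set R) (a : R -> R -> R)
    (f : R -> R -> vec3 R -> R) : Prop :=
  (forall t m p, J t -> 0 < m -> 0 <= f t m p) /\
  forall t m p, J t -> 0 < m ->
    let gain (p' : vec3 R) (m' : R) :=
      a m' (m - m') * f t m' p' * f t (m - m') (p - p') in
    let loss (p' : vec3 R) (m' : R) := a m m' * f t m p * f t m' p' in
    [/\ (leb3 \x leb)%E.-integrable ([set: vec3 R] `*` `]0, m[)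
          (fun z => (gain z.1 z.2)%:E),
        (leb3 \x leb)%E.-integrable ([set: vec3 R] `*` `]0, +oo[)
          (fun z => (loss z.1 z.2)%:E)
      & is_derive t 1 (fun s => f s m p)
          (2^-1 * (\int[leb3]_p' (\int[leb]_(m' in `]0%R, m[) gain p' m'))
           - \int[leb3]_p' (\int[leb]_(m' in `]0%R, +oo[) loss p' m'))].

Definition coagulation_self_similar (R : realType) (J : set R)
    (F : R -> R -> R) : Prop :=
  exists (Phi : R -> R) (nu mu : R -> R),
    (forall t, J t -> 0 < nu t /\ 0 < mu t) /\
    forall t m, J t -> 0 < m -> F t m = nu t * Phi (mu t * m).

Definition ballistic_self_similar (R : realType) (J : set R)
    (f : R -> R -> vec3 R -> R) : Prop :=
  exists (Psi : R -> vec3 R -> R) (lambda mu1 mu2 : R -> R),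
    (forall t, J t -> [/\ 0 < lambda t, 0 < mu1 t & 0 < mu2 t]) /\
    forall t m p, J t -> 0 < m ->
      f t m p = lambda t * Psi (mu1 t * m) (mu2 t *: p).

(* Main.v *)
(** The product [f] is the law of mass [m], weighted by [F t m], with momentum
    distributed according to the inverse Fourier transform [phi_m] of
    [exp (- m b)]: homogeneity of [b] turns [exp (- b (m^theta eta))] into
    [exp (- m b eta)].  Hence the [phi_m] are probability densities forming a
    convolution semigroup, [phi_s * phi_t = phi_(s + t)], and integrating out
    the momentum variable leaves the coagulation equation multiplied by
    [phi_m p].

    What has to be justified is Fourier inversion for [phi >= 0]: multiplying
    [phi] by [exp (- e |q_i|)] in each coordinate corresponds to averaging
    [exp (- b)] against the Poisson (Cauchy) kernel; letting [e] tend to [0],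
    monotone convergence gives integrability of [phi] and dominated convergence
    the inversion formula.  The bound [exp (- b) <= 1] needed there comes from
    integrability: if [b < 0] on a box, scaling the box by [l] would give
    [exp (- b)] an integral of order at least [l^3]. *)

Require Import Defs.
From HB Require Import structures.
From mathcomp Require Import all_boot all_order all_algebra.
From mathcomp Require Import all_classical all_reals all_analysis.
From mathcomp Require Import complex measurable_realfun ring lra.

Set Implicit Arguments.
Unset Strict Implicit.
Unset Printing Implicit Defensive.

Import Order.TTheory GRing.Theory Num.Theory.
Import numFieldNormedType.Exports.

Local Open Scope classical_set_scope.
Local Open Scope ring_scope.

(** * Product measures *)

Section product_measure.
Context d1 d2 (T1 : measurableType d1) (T2 : measurableType d2) (R : realType)
  (m1 : {sigma_finite_measure set T1 -> \bar R})
  (m2 : {sigma_finite_measure set T2 -> \bar R}).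

Lemma sigma_finite_product_measure : sigma_finite setT (m1 \x m2)%E.
Proof.
have /sigma_finiteP[F [TF ndF Foo]] := sigma_finiteT m1.
have /sigma_finiteP[G [TG ndG Goo]] := sigma_finiteT m2.
exists (fun n => F n `*` G n).
  rewrite -setXTT TF TG predeqE => -[x y]; split.
    (* Both exhausting sequences increase, so the larger of the two indices serves both
       coordinates. *)
    move=> [/= [n _ Fnx] [k _ Gky]]; exists (maxn n k) => //; split.
    - by move: x Fnx; exact/subsetPset/ndF/leq_maxl.
    - by move: y Gky; exact/subsetPset/ndG/leq_maxr.
  by move=> [n _ []/= ? ?]; split; exists n.
move=> k; have [? ?] := Foo k; have [? ?] := Goo k.
split; first exact: measurableX.
by rewrite product_measure1E// lte_mul_pinfty// ge0_fin_numE.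
Qed.

(* The library declares this structure on [m1 \x m2] only for
   subprobabilities. *)
Definition prod_sigma_finite :
    {sigma_finite_measure set (T1 * T2)%type -> \bar R} :=
  HB.pack (m1 \x m2)%E (@Measure_isSigmaFinite.Build _ _ _ (m1 \x m2)%E
    sigma_finite_product_measure).

End product_measure.

Section product_integral.
Context d1 d2 (T1 : measurableType d1) (T2 : measurableType d2) (R : realType)
  (m1 : {sigma_finite_measure set T1 -> \bar R})
  (m2 : {sigma_finite_measure set T2 -> \bar R}).

(** By Tonelli, the integral of [|u v|] is the product of two finite integrals. *)
Lemma integrable_tensor (u : T1 -> R) (v : T2 -> R) :
  m1.-integrable setT (EFin \o u) -> m2.-integrable setT (EFin \o v) ->
  (prod_sigma_finite m1 m2).-integrable setT
    (EFin \o (fun z => u z.1 * v z.2)).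
Proof.
move=> iu iv.
have mu : measurable_fun setT u by apply/measurable_EFinP; case/integrableP: iu.
have mv : measurable_fun setT v by apply/measurable_EFinP; case/integrableP: iv.
apply/integrable12ltyP => /=.
  by apply/measurable_EFinP/measurable_funM; apply: measurableT_comp.
have [_ vlty] := integrableP _ _ _ iv.
have [_ ulty] := integrableP _ _ _ iu.
under eq_integral => x _.
  under eq_integral do rewrite /= normrM EFinM.
  rewrite ge0_integralZl//; last by do 2 apply: measurableT_comp.
  over.
rewrite ge0_integralZr//.
- rewrite lte_mul_pinfty//; first exact: integral_ge0.
  by rewrite ge0_fin_numE//; apply: integral_ge0.
- by do 2 apply: measurableT_comp.
- exact: integral_ge0.
Qed.

(** Fubini for real-valued integrals: on the null set of [x] with a non-integrable section, the real
    inner integral may differ from the extended one, which affects neither integrability nor the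
    outer integral. *)
Lemma integrable_section1 (f : T1 * T2 -> R) :
  (prod_sigma_finite m1 m2).-integrable setT (EFin \o f) ->
  m1.-integrable setT (fun x => (\int[m2]_y f (x, y))%:E) /\
  \int[m1]_x \int[m2]_y f (x, y) = \int[prod_sigma_finite m1 m2]_z f z.
Proof.
move=> intf.
have aeE : {ae m1, forall x, setT x ->
    fubini_F m2 (EFin \o f) x = (\int[m2]_y f (x, y))%:E}.
  have := ae_integrable1 intf; apply: filterS => x ix _.
  by rewrite /fubini_F /Rintegral fineK//; exact: integrable_fin_num.
have mF : measurable_fun setT (fubini_F m2 (EFin \o f)).
  exact: measurable_fubini_F intf.
have mG : measurable_fun setT (fun x => (\int[m2]_y f (x, y))%:E).
  by apply/measurable_EFinP; apply: measurableT_comp mF; exact: fine_measurable.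
split.
  (* [fine] sends infinite values to 0, so it never increases the absolute value. *)
  apply: le_integrable (integrable_fubini_F intf) => // z _ /=.
  rewrite /Rintegral /fubini_F.
  by case: (integral _ _ _) => [r||] /=; rewrite ?normr0 ?leey.
rewrite /Rintegral -[in RHS]integral12_prod_meas1//; congr fine.
by apply: ae_eq_integral => //; apply: filterS aeE => x + xT => /(_ xT) ->.
Qed.

Lemma integrable_section2 (f : T1 * T2 -> R) :
  (prod_sigma_finite m1 m2).-integrable setT (EFin \o f) ->
  m2.-integrable setT (fun y => (\int[m1]_x f (x, y))%:E) /\
  \int[m2]_y \int[m1]_x f (x, y) = \int[prod_sigma_finite m1 m2]_z f z.
Proof.
move=> intf.
have aeE : {ae m2, forall y, setT y ->
    fubini_G m1 (EFin \o f) y = (\int[m1]_x f (x, y))%:E}.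
  have := ae_integrable2 intf; apply: filterS => x ix _.
  by rewrite /fubini_G /Rintegral fineK//; exact: integrable_fin_num.
have mF : measurable_fun setT (fubini_G m1 (EFin \o f)).
  exact: measurable_fubini_G intf.
have mG : measurable_fun setT (fun y => (\int[m1]_x f (x, y))%:E).
  by apply/measurable_EFinP; apply: measurableT_comp mF; exact: fine_measurable.
split.
  have mf := measurable_int _ intf.
  apply/integrableP; split=> //.
  move/(integrable21ltyP m1 m2 mf): intf; apply: le_lt_trans.
  apply: ge0_le_integral => //.
  - exact: measurableT_comp.
  - apply: (measurable_fun_fubini_tonelli_G (abse \o (EFin \o f))).
      exact: measurableT_comp.
    by move=> z; exact: abse_ge0.
  - move=> y _; apply: le_trans (le_abse_integral m1 measurableT _); last first.
      by apply: measurableT_comp mf _; exact: pair2_measurable.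
    rewrite /Rintegral.
    by case: (integral _ _ _) => [r||] /=; rewrite ?normr0 ?leey.
rewrite /Rintegral -[in RHS]integral21_prod_meas1//; congr fine.
by apply: ae_eq_integral => //; apply: filterS aeE => x + xT => /(_ xT) ->.
Qed.

Lemma Rintegral_Fubini (f : T1 * T2 -> R) :
  (prod_sigma_finite m1 m2).-integrable setT (EFin \o f) ->
  \int[m1]_x \int[m2]_y f (x, y) = \int[m2]_y \int[m1]_x f (x, y).
Proof.
move=> intf.
by rewrite (integrable_section1 intf).2 (integrable_section2 intf).2.
Qed.

End product_integral.

Lemma integrable_Mbounded d (T : measurableType d) (R : realType)
    (m : {measure set T -> \bar R}) (u w : T -> R) (M : R) :
  m.-integrable setT (EFin \o u) -> measurable_fun setT w ->
  (forall x, `|w x| <= M) ->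
  m.-integrable setT (EFin \o (fun x => u x * w x)).
Proof.
move=> iu mw wM.
have mu : measurable_fun setT u by apply/measurable_EFinP; case/integrableP: iu.
apply: (@le_integrable _ _ _ _ _ _ _ (fun x => (M * u x)%:E)) => //.
- by apply/measurable_EFinP/measurable_funM.
- move=> x _ /=; rewrite lee_fin !normrM mulrC ler_wpM2r//.
  by rewrite (le_trans (wM x))// ler_norm.
- exact: (integrableZl measurableT M iu).
Qed.

Lemma measurable_fun_cos (R : realType) : measurable_fun setT (@cos R).
Proof. by apply: continuous_measurable_fun; exact: continuous_cos. Qed.

Lemma normr_cos_le1 (R : realType) (x : R) : `|cos x| <= 1.
Proof. by rewrite ler_norml cos_geN1 cos_le1. Qed.

(** * Cosine integrals on product spaces *)

Section cosine_integrals.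
Context d1 d2 (T1 : measurableType d1) (T2 : measurableType d2) (R : realType)
  (m1 : {sigma_finite_measure set T1 -> \bar R})
  (m2 : {sigma_finite_measure set T2 -> \bar R}).

(** Fubini applies because the common integrand [u v cos w] is dominated by the integrable
    [|u v|]. *)
Lemma Rintegral_cos_swap (u : T1 -> R) (v : T2 -> R) (w : T1 * T2 -> R) :
  m1.-integrable setT (EFin \o u) -> m2.-integrable setT (EFin \o v) ->
  measurable_fun setT w ->
  \int[m1]_x (u x * \int[m2]_y (v y * cos (w (x, y)))) =
  \int[m2]_y (v y * \int[m1]_x (u x * cos (w (x, y)))).
Proof.
move=> iu iv mw.
have mcw : measurable_fun setT (fun z => cos (w z)).
  by apply: measurableT_comp mw; exact: measurable_fun_cos.
have mu : measurable_fun setT u by apply/measurable_EFinP; case/integrableP: iu.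
have mv : measurable_fun setT v by apply/measurable_EFinP; case/integrableP: iv.
have iuv := integrable_Mbounded (integrable_tensor iu iv) mcw
  (fun z => normr_cos_le1 (w z)).
have iu_ y : m1.-integrable setT (EFin \o (fun x => u x * cos (w (x, y)))).
  apply: integrable_Mbounded iu _ (fun x => normr_cos_le1 (w (x, y))).
  by apply: measurableT_comp mcw _; exact: pair2_measurable.
have iv_ x : m2.-integrable setT (EFin \o (fun y => v y * cos (w (x, y)))).
  apply: integrable_Mbounded iv _ (fun y => normr_cos_le1 (w (x, y))).
  by apply: measurableT_comp mcw _; exact: pair1_measurable.
transitivity (\int[m1]_x \int[m2]_y (u x * v y * cos (w (x, y)))).
  apply: eq_Rintegral => x _; rewrite -RintegralZl//.
  by apply: eq_Rintegral => y _; rewrite mulrA.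
rewrite (Rintegral_Fubini iuv).
apply: eq_Rintegral => y _; rewrite -RintegralZl//.
by apply: eq_Rintegral => x _; rewrite /= mulrAC mulrC mulrA.
Qed.

(* Quantifying over the phase [c] encodes the complex identity
   [\int u e^(i th) = U], [U] real. *)
Definition cos_integral d (T : measurableType d)
    (m : {measure set T -> \bar R}) (u th : T -> R) (U : R) :=
  forall c, \int[m]_x (u x * cos (th x + c)) = U * cos c.

(** The inner integral is taken with the phase [th x + c]; it yields [V] times a cosine in [x] to
    which the first hypothesis applies. In complex form, the integral of a product of exponentials
    factors. *)
Lemma cos_integral_prod (u th : T1 -> R) (v eta : T2 -> R) (U V : R) :
  m1.-integrable setT (EFin \o u) -> m2.-integrable setT (EFin \o v) ->
  measurable_fun setT th -> measurable_fun setT eta ->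
  cos_integral m1 u th U -> cos_integral m2 v eta V ->
  cos_integral (prod_sigma_finite m1 m2) (fun z => u z.1 * v z.2)
    (fun z => th z.1 + eta z.2) (U * V).
Proof.
move=> iu iv mth meta hu hv c.
have mcw : measurable_fun setT
    (fun z : T1 * T2 => cos (th z.1 + eta z.2 + c)).
  apply: measurableT_comp; first exact: measurable_fun_cos.
  by do 2 apply: measurable_funD => //; apply: measurableT_comp.
have iuv := integrable_Mbounded (integrable_tensor iu iv) mcw
  (fun z => normr_cos_le1 _).
rewrite -(integrable_section1 iuv).2 /=.
have iv_ x : m2.-integrable setT
    (EFin \o (fun y => v y * cos (th x + eta y + c))).
  apply: integrable_Mbounded iv _ (fun y => normr_cos_le1 _).
  apply: measurableT_comp; first exact: measurable_fun_cos.
  by do 2 apply: measurable_funD => //.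
transitivity (\int[m1]_x (V * (u x * cos (th x + c)))).
  apply: eq_Rintegral => x _.
  transitivity (\int[m2]_y (u x * (v y * cos (eta y + (th x + c))))).
    apply: eq_Rintegral => y _; rewrite mulrA; congr (_ * cos _).
    by rewrite addrA (addrC (eta y)).
  rewrite RintegralZl ?hv//; first by rewrite mulrCA.
  apply: integrable_Mbounded iv _ (fun y => normr_cos_le1 _).
  apply: measurableT_comp; first exact: measurable_fun_cos.
  exact: measurable_funD.
rewrite RintegralZl ?hu//; first by rewrite mulrA (mulrC V).
apply: integrable_Mbounded iu _ (fun y => normr_cos_le1 _).
apply: measurableT_comp; first exact: measurable_fun_cos.
exact: measurable_funD.
Qed.

End cosine_integrals.

(** * Changes of variables *)

Section scales_measure.
Context (R : realType).

(** [m] is [k] times its image under [T]: for a change of variables [T], the number [k] is the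
    constant Jacobian. *)
Definition scales_measure d (X : measurableType d)
    (m : {measure set X -> \bar R}) (T : X -> X) (k : R) :=
  measurable_fun setT T /\
  forall A, measurable A -> (m A = k%:E * m (T @^-1` A))%E.

Section integral.
Context d (X : measurableType d) (m : {measure set X -> \bar R})
  (T : X -> X) (k : R).
Hypotheses (k_gt0 : 0 < k) (Tk : scales_measure m T k).

Let mT : measurable_fun setT T := Tk.1.

Lemma ge0_integral_scales (h : X -> \bar R) :
  measurable_fun setT h -> (forall x, 0 <= h x)%E ->
  (\int[m]_x h x = k%:E * \int[m]_x h (T x))%E.
Proof.
move=> mh h0.
have mTE A : measurable A -> A `<=` setT ->
    m A = mscale (NngNum (ltW k_gt0)) (pushforward m T) A.
  by move=> mA _; rewrite /mscale /= Tk.2.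
rewrite (eq_measure_integral _ (fun A mA sA => mTE mT A mA sA)).
rewrite ge0_integral_mscale//; congr (_ * _)%E.
by rewrite (ge0_integral_pushforward mT).
Qed.

Lemma integrable_scales (h : X -> R) : m.-integrable setT (EFin \o h) ->
  m.-integrable setT (EFin \o (h \o T)).
Proof.
move=> ih; have [mh hlty] := integrableP _ _ _ ih.
have mah : measurable_fun setT (fun x => `|(EFin \o h) x|%E).
  exact: measurableT_comp.
have ah0 x : (0 <= `|(EFin \o h) x|)%E by exact: abse_ge0.
rewrite (ge0_integral_scales mah ah0) in hlty.
apply/integrableP; split; first exact: measurableT_comp mh mT.
move: hlty; case: (integral _ _ _) => [r||]//=; rewrite ?ltry//.
by rewrite mulry gtr0_sg// mul1e.
Qed.

(** The nonnegative case is applied to the positive and negative parts, both of finite integral. *)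
Lemma Rintegral_scales (h : X -> R) : m.-integrable setT (EFin \o h) ->
  \int[m]_x h x = k * \int[m]_x h (T x).
Proof.
move=> ih; have ihT := integrable_scales ih.
have [mh _] := integrableP _ _ _ ih.
have Ipos : (\int[m]_x (EFin \o h)^\+ x =
    k%:E * \int[m]_x (EFin \o (h \o T))^\+ x)%E.
  rewrite (ge0_integral_scales (measurable_funepos mh) (funepos_ge0 _)).
  by congr (_ * _)%E; apply: eq_integral => x _; rewrite !funeposE.
have Ineg : (\int[m]_x (EFin \o h)^\- x =
    k%:E * \int[m]_x (EFin \o (h \o T))^\- x)%E.
  rewrite (ge0_integral_scales (measurable_funeneg mh) (funeneg_ge0 _)).
  by congr (_ * _)%E; apply: eq_integral => x _; rewrite !funenegE.
have eL := integralE m setT (EFin \o h).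
have eR := integralE m setT (EFin \o (h \o T)).
have fp := integrable_pos_fin_num measurableT ihT.
have fn := integrable_neg_fin_num measurableT ihT.
rewrite /Rintegral [X in fine X = _]eL [X in _ = _ * fine X]eR Ipos Ineg.
by rewrite -(fineK fp) -(fineK fn) /= mulrBr.
Qed.

End integral.

End scales_measure.

(** The rescaled image measure agrees with the product measure on rectangles, which determine the
    latter. *)
Lemma scales_measure_prod (R : realType) d1 d2 (X1 : measurableType d1)
    (X2 : measurableType d2)
    (m1 : {sigma_finite_measure set X1 -> \bar R})
    (m2 : {sigma_finite_measure set X2 -> \bar R}) (T1 : X1 -> X1)
    (T2 : X2 -> X2) (k1 k2 : R) : 0 <= k1 -> 0 <= k2 ->
  scales_measure m1 T1 k1 -> scales_measure m2 T2 k2 ->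
  scales_measure (prod_sigma_finite m1 m2) (fun z => (T1 z.1, T2 z.2))
    (k1 * k2).
Proof.
move=> k1_ge0 k2_ge0 [mT1 T1k] [mT2 T2k].
have mT : measurable_fun setT (fun z : X1 * X2 => (T1 z.1, T2 z.2)).
  by apply: measurable_fun_pair; exact: measurableT_comp.
split=> // A mA.
pose m' : {measure set (X1 * X2)%type -> \bar R} :=
  mscale (NngNum (mulr_ge0 k1_ge0 k2_ge0))
    (pushforward (m1 \x m2)%E (fun z => (T1 z.1, T2 z.2))).
apply: (@product_measure_unique _ _ _ _ _ m1 m2 (m' mT)) => //.
move=> B1 B2 mB1 mB2.
change ((k1 * k2)%:E *
  (m1 \x m2) ((T1 @^-1` B1) `*` (T2 @^-1` B2)) = m1 B1 * m2 B2)%E.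
rewrite product_measure1E; first last.
- by rewrite -[X in measurable X]setTI; exact: mT2.
- by rewrite -[X in measurable X]setTI; exact: mT1.
by rewrite EFinM muleACA -T1k// -T2k.
Qed.

(** Lebesgue measure is determined by its values on half-open intervals, and the preimage of such an
    interval is again one, with length divided by [k]. *)
Lemma scales_measure_lebesgue (R : realType) (c k : R) : 0 < k ->
  scales_measure (@lebesgue_measure R) (fun x => c + k * x) k.
Proof.
move=> k0.
have mT : measurable_fun setT (fun x : measurableTypeR R => c + k * x).
  by apply: measurable_funD => //; apply: measurable_funM.
split=> // A mA.
pose m' : {measure set (measurableTypeR R) -> \bar R} :=
  mscale (NngNum (ltW k0)) 
    (@pushforward _ _ (measurableTypeR R) (measurableTypeR R) R leb
      (fun x => c + k * x)).
apply: (@lebesgue_measure_unique _ (m' mT)) => //.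
move=> X [[a b] _ <-] /=.
change (leb `]a, b] =
  k%:E * leb ((fun x : R => c + k * x)%R @^-1` `]a, b]))%E.
rewrite (_ : _ @^-1` _ = `](a - c) / k, (b - c) / k]%classic); last first.
  apply/seteqP; split=> x /=; rewrite !in_itv/= ltr_pdivrMr// ler_pdivlMr//;
    by rewrite ltrBlDl lerBrDl (mulrC x).
rewrite !lebesgue_measure_itv/= !lte_fin ltr_pM2r ?invr_gt0// ltrD2r.
case: ifPn => _; last by rewrite mule0.
rewrite -!EFinB -EFinM; congr EFin; field; exact: lt0r_neq0.
Qed.

(** * The Laplace and Cauchy kernels *)

Lemma scales_measure_lebesgueN (R : realType) :
  scales_measure (@lebesgue_measure R) -%R 1.
Proof.
have mT : measurable_fun setT (-%R : measurableTypeR R -> measurableTypeR R).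
  exact: measurable_funN.
split=> // A mA.
pose m' : {measure set (measurableTypeR R) -> \bar R} :=
  @pushforward _ _ (measurableTypeR R) (measurableTypeR R) R leb -%R.
rewrite mul1e.
apply: (@lebesgue_measure_unique _ (m' mT)) => //.
move=> X [[a b] _ <-] /=.
change (leb `]a, b] = leb (-%R @^-1` `]a, b] : set (measurableTypeR R)))%E.
rewrite (_ : _ @^-1` _ = `[- b, - a[%classic); last first.
  by apply/seteqP; split=> x /=; rewrite !in_itv/= lerNl ltrNr andbC.
by rewrite !lebesgue_measure_itv/= !lte_fin ltrN2 opprK addrC.
Qed.

Section laplace_kernel.
Context (R : realType).
Implicit Types (e t s x : R).

(** The regularizing factor; its Fourier transform is the Poisson kernel [2 e / (e^2 + t^2)]. *)
Definition laplace e x := expR (- (e * `|x|)).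

Lemma laplace_gt0 e x : 0 < laplace e x.
Proof. exact: expR_gt0. Qed.

Lemma continuous_laplace e : continuous (laplace e).
Proof.
move=> x; apply: continuous_comp; last exact: continuous_expR.
by apply: cvgN; apply: cvgM; [exact: cvg_cst|exact: norm_continuous].
Qed.

(** The weight [1 + s cos] keeps the integrand nonnegative, so the fundamental theorem of calculus
    applies on the half-line; comparing [s = 0] with [s = 1] later isolates the cosine. *)
Lemma integral_laplace_cos_half e t s : 0 < e -> -1 <= s <= 1 ->
  (\int[leb]_(x in `[0%R, +oo[) (expR (- (e * x)) * (1 + s * cos (t * x)))%:E
   = (e^-1 + s * (e / (e ^+ 2 + t ^+ 2)))%:E)%E.
Proof.
move=> e0 s1.
have d0 : e ^+ 2 + t ^+ 2 != 0.
  by rewrite gt_eqF// ltr_pwDl ?sqr_ge0 ?exprn_gt0.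
have en0 : e != 0 by rewrite gt_eqF.
(* [expR (- (e * x)) * G x] is an explicit antiderivative; [G] is bounded, so it tends to 0 at
   infinity. *)
pose G x := - e^-1 + s * ((t * sin (t * x) - e * cos (t * x)) /
  (e ^+ 2 + t ^+ 2)).
pose F x := expR (- (e * x)) * G x.
have dF x : is_derive x 1 F (expR (- (e * x)) * (1 + s * cos (t * x))).
  rewrite /F /G; apply: is_derive_eq.
  rewrite /GRing.scale /=; field.
  by rewrite en0 d0.
have FV x : derive1 F x = expR (- (e * x)) * (1 + s * cos (t * x)).
  by rewrite derive1E; exact: derive_val.
rewrite (@ge0_continuous_FTC2y _ _ F 0 0).
- rewrite sub0e /F /G !mulr0 oppr0 expR0 sin0 cos0; congr EFin; field.
  by rewrite en0 d0.
- move=> x x0; rewrite mulr_ge0 ?expR_ge0//.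
  have := ler_norml (cos (t * x)) 1; rewrite normr_cos_le1 => /esym/andP[c1 c2].
  nra.
- apply: continuous_subspaceT => x; apply: differentiable_continuous.
  exact/derivable1_diffP.
- have Ee : expR (- (e * x)) @[x --> +oo%R] --> (0 : R).
    apply: (@cvg_comp _ _ _ ( *%R e) (fun y => expR (- y))); last first.
      exact: cvgr_expR.
    by apply: gt0_cvgMry => //; exact: cvg_id.
  pose M := e^-1 + (`|t| + e) / (e ^+ 2 + t ^+ 2).
  have GM x : `|G x| <= M.
    have [s1l s1r] := andP s1.
    have dp : 0 < e ^+ 2 + t ^+ 2 by rewrite lt_def d0 addr_ge0// sqr_ge0.
    rewrite (le_trans (ler_normD _ _))// lerD//.
      by rewrite normrN ger0_norm// invr_ge0 ltW.
    rewrite normrM -[leRHS]mul1r ler_pM//; first by rewrite ler_norml s1l.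
    rewrite normrM [X in _ * X]ger0_norm ?invr_ge0 ?(ltW dp)//.
    rewrite ler_pM2r ?invr_gt0// (le_trans (ler_normB _ _))// !normrM lerD//.
      by rewrite -[leRHS]mulr1 ler_wpM2l// ler_norml sin_geN1 sin_le1.
    by rewrite (gtr0_norm e0) -[leRHS]mulr1 ler_wpM2l ?(ltW e0) ?normr_cos_le1.
  apply: (@squeeze_cvgr _ _ _ _ (fun x => expR (- (e * x)) * - M)
      (fun x => expR (- (e * x)) * M)).
  + near=> x; rewrite /F !ler_pM2l ?expR_gt0//.
    by move: (GM x); rewrite ler_norml.
  + by rewrite -[X in _ --> X](mul0r (- M)); apply: cvgM => //; exact: cvg_cst.
  + by rewrite -[X in _ --> X](mul0r M); apply: cvgM => //; exact: cvg_cst.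
- by move=> x _; apply: ex_derive.
- apply: cvg_at_right_filter; apply: differentiable_continuous.
  exact/derivable1_diffP/ex_derive.
- by move=> x _; rewrite FV.
Unshelve. all: by end_near. Qed.

Lemma integral_laplace_cos1 e t s : 0 < e -> -1 <= s <= 1 ->
  (\int[leb]_x (laplace e x * (1 + s * cos (t * x)))%:E
   = (2 / e + s * (2 * e / (e ^+ 2 + t ^+ 2)))%:E)%E.
Proof.
move=> e0 s1; have [s1l s1r] := andP s1.
rewrite ge0_symfun_integralT.
- rewrite -set_itvcy.
  rewrite (_ : (\int[_]_(x in _) _ =
      (e^-1 + s * (e / (e ^+ 2 + t ^+ 2)))%:E)%E).
    by rewrite -EFinM mulrDr mulrCA !mulrA.
  rewrite -integral_laplace_cos_half//; apply: eq_integral => x.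
  by rewrite inE/= in_itv/= andbT => x0; rewrite /laplace ger0_norm.
- move=> x; rewrite mulr_ge0 ?expR_ge0//.
  by have := normr_cos_le1 (t * x); rewrite ler_norml => /andP[c1 c2]; nra.
- move=> x; apply: cvgM; first exact: continuous_laplace.
  apply: cvgD; first exact: cvg_cst.
  apply: cvgM; first exact: cvg_cst.
  apply: continuous_comp; last exact: continuous_cos.
  by apply: cvgM; [exact: cvg_cst|exact: cvg_id].
- by move=> x /=; rewrite /laplace normrN mulrN cosN.
Qed.

Lemma measurable_laplace e : measurable_fun setT (laplace e).
Proof. exact: continuous_measurable_fun (@continuous_laplace e). Qed.

Lemma integrable_laplace e : 0 < e -> leb.-integrable setT (EFin \o laplace e).
Proof.
move=> e0; apply/integrableP; split.
  by apply/measurable_EFinP; exact: measurable_laplace.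
have s0 : -1 <= (0 : R) <= 1 by rewrite oppr_le0 ler01.
have := integral_laplace_cos1 0 e0 s0.
under eq_integral do rewrite mul0r addr0 mulr1.
move=> E; under eq_integral do rewrite /= ger0_norm ?(ltW (laplace_gt0 _ _))//.
by rewrite E ltry.
Qed.

(** The addition formula separates the phase [c]; the cosine part is the difference of the cases
    [s = 1] and [s = 0], and the sine part vanishes by oddness. *)
Lemma cos_integral_laplace e t : 0 < e ->
  cos_integral leb (laplace e) ( *%R t) (2 * e / (e ^+ 2 + t ^+ 2)).
Proof.
move=> e0 c.
have ie := integrable_laplace e0.
have mt : measurable_fun setT (fun x : measurableTypeR R => t * x).
  exact: measurable_funM.
have ic : leb.-integrable setT (EFin \o (fun x => laplace e x * cos (t * x))).
  apply: integrable_Mbounded ie _ (fun x => normr_cos_le1 _).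
  by apply: measurableT_comp mt; exact: measurable_fun_cos.
have is_ : leb.-integrable setT (EFin \o (fun x => laplace e x * sin (t * x))).
  apply: (@integrable_Mbounded _ _ _ _ _ _ 1 ie).
    apply: measurableT_comp mt; apply: continuous_measurable_fun.
    exact: continuous_sin.
  by move=> x; rewrite ler_norml sin_geN1 sin_le1.
have s0 : -1 <= (0 : R) <= 1 by rewrite oppr_le0 ler01.
have s1 : -1 <= (1 : R) <= 1.
  by rewrite lexx (le_trans _ ler01)// oppr_le0 ler01.
have Ic : \int[leb]_x (laplace e x * cos (t * x)) = 2 * e / (e ^+ 2 + t ^+ 2).
  have I0 := integral_laplace_cos1 t e0 s0.
  have I1 := integral_laplace_cos1 t e0 s1.
  have E1 : \int[leb]_x (laplace e x * (1 + 1 * cos (t * x))) =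
      \int[leb]_x laplace e x + \int[leb]_x (laplace e x * cos (t * x)).
    rewrite -RintegralD//; apply: eq_Rintegral => x _.
    by rewrite mul1r mulrDr mulr1.
  have E0 : \int[leb]_x (laplace e x * (1 + 0 * cos (t * x))) =
      \int[leb]_x laplace e x.
    by apply: eq_Rintegral => x _; rewrite mul0r addr0 mulr1.
  move: E1; rewrite -E0 /Rintegral I0 I1 /= mul0r addr0 mul1r.
  by move/addrI.
(* The substitution [x -> - x] shows that this integral equals its own opposite. *)
have Is : \int[leb]_x (laplace e x * sin (t * x)) = 0.
  have := Rintegral_scales ltr01 (@scales_measure_lebesgueN R) is_.
  rewrite mul1r => E; apply/eqP; rewrite -eqNr; apply/eqP.
  rewrite [RHS]E -mulN1r -RintegralZl//; apply: eq_Rintegral => x _ /=.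
  by rewrite /laplace normrN mulrN sinN mulN1r mulrN.
transitivity (\int[leb]_x (laplace e x * cos (t * x) * cos c -
    laplace e x * sin (t * x) * sin c)).
  by apply: eq_Rintegral => x _; rewrite cosD mulrBr !mulrA.
rewrite RintegralB//.
- by rewrite !RintegralZr// Ic Is mul0r subr0.
- exact: (integrableZr measurableT (cos c) ic).
- exact: (integrableZr measurableT (sin c) is_).
Qed.

End laplace_kernel.

Section cauchy_kernel.
Context (R : realType).

(** Normalized to total mass [2 pi], so that the product over three coordinates has mass [(2 pi)^3],
    the constant of Fourier inversion. *)
Definition cauchy (x : R) := 2 / (1 + x ^+ 2).

Lemma continuous_cauchy : continuous cauchy.
Proof.
by move=> x; apply: cvgM; [exact: cvg_cst|exact: continuous_oneDsqrV].
Qed.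

Lemma cauchy_ge0 (x : R) : 0 <= cauchy x.
Proof. by rewrite divr_ge0 ?addr_ge0 ?sqr_ge0. Qed.

Lemma cauchy_bounds (x : R) : 0 <= cauchy x <= 2.
Proof.
rewrite cauchy_ge0 /cauchy ler_pdivrMr ?ltr_pwDl ?sqr_ge0//.
by rewrite ler_peMr// lerDl sqr_ge0.
Qed.

Lemma integral_cauchy : (\int[leb]_x (cauchy x)%:E = (2 * pi)%:E)%E.
Proof.
rewrite ge0_symfun_integralT.
- rewrite -set_itvcy.
  rewrite (_ : (\int[_]_(x in _) _ = pi%:E)%E) -?EFinM//.
  have := @integral0y_oneDsqr R.
  move/(congr1 (fun z => 2%:E * z)%E); rewrite -ge0_integralZl//.
  + by rewrite -EFinM mulrCA divff ?mulr1// => <-.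
  + apply/measurable_EFinP; apply: measurable_funTS.
    by apply: continuous_measurable_fun; exact: continuous_oneDsqrV.
- by move=> x; exact: cauchy_ge0.
- exact: continuous_cauchy.
- by move=> x /=; rewrite /cauchy sqrrN.
Qed.

Lemma measurable_cauchy : measurable_fun setT cauchy.
Proof. exact: continuous_measurable_fun continuous_cauchy. Qed.

Lemma integrable_cauchy : leb.-integrable setT (EFin \o cauchy).
Proof.
apply/integrableP; split.
  by apply/measurable_EFinP; exact: measurable_cauchy.
under eq_integral do rewrite /= ger0_norm ?cauchy_ge0//.
by rewrite integral_cauchy ltry.
Qed.

Lemma Rintegral_cauchy : \int[leb]_x cauchy x = 2 * pi.
Proof. by rewrite /Rintegral integral_cauchy. Qed.

End cauchy_kernel.

(** * Integrals of tensor products and dominated convergence *)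

Lemma Rintegral_tensor d1 d2 (T1 : measurableType d1) (T2 : measurableType d2)
    (R : realType) (m1 : {sigma_finite_measure set T1 -> \bar R})
    (m2 : {sigma_finite_measure set T2 -> \bar R}) (u : T1 -> R) (v : T2 -> R) :
  m1.-integrable setT (EFin \o u) -> m2.-integrable setT (EFin \o v) ->
  \int[prod_sigma_finite m1 m2]_z (u z.1 * v z.2) =
  \int[m1]_x u x * \int[m2]_y v y.
Proof.
move=> iu iv; rewrite -(integrable_section1 (integrable_tensor iu iv)).2 /=.
rewrite -RintegralZr//; apply: eq_Rintegral => x _.
exact: RintegralZl.
Qed.

(** The bound by [g] passes to the limit [f], whose integral is therefore finite; taking real parts
    of the extended integrals then preserves the convergence. *)
Lemma cvg_Rintegral_dominated d (T : measurableType d) (R : realType)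
    (m : {measure set T -> \bar R}) (f_ : nat -> T -> R) (f g : T -> R) :
  (forall n, measurable_fun setT (f_ n)) ->
  (forall x, f_ n x @[n --> \oo] --> f x) ->
  m.-integrable setT (EFin \o g) ->
  (forall n x, `|f_ n x| <= g x) ->
  \int[m]_x f_ n x @[n --> \oo] --> \int[m]_x f x.
Proof.
move=> mf fcvg ig fg.
have mfn n : measurable_fun setT (EFin \o f_ n) by apply/measurable_EFinP.
have fcvg' x : setT x -> (EFin \o f_ n) x @[n --> \oo] --> (EFin \o f) x.
  by move=> _; apply: cvg_EFin; [exact: nearW|exact: fcvg].
have fg' n x : setT x -> (`|(EFin \o f_ n) x| <= (EFin \o g) x)%E.
  by move=> _; rewrite /= lee_fin.
have gfin x : setT x -> (EFin \o g) x \is a fin_num by [].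
have mg := measurable_int _ ig.
have mlim : measurable_fun setT (EFin \o f).
  by apply/measurable_EFinP; apply: measurable_fun_cvg mf _ => x _; exact: fcvg.
have iF : m.-integrable setT (EFin \o f).
  apply: le_integrable ig => // x _; rewrite /= lee_fin.
  rewrite (le_trans _ (ler_norm _))//.
  have nc : `|f_ n x| @[n --> \oo] --> `|f x| by apply: cvg_norm; exact: fcvg.
  by apply: (cvgr_to_le nc); apply: nearW => n; exact: fg.
have := dominated_cvg measurableT mfn fcvg' gfin ig fg'.
rewrite -[X in _ --> X]fineK; last exact: integrable_fin_num.
exact: fine_cvg.
Qed.

(* [mvec3 R] and [leb3s] are convertible to [vec3 R] and [leb3]; they only fix
   the measurable structure and the sigma-finite measure structure. *)
Notation mvec3 R :=
  (measurableTypeR R * measurableTypeR R * measurableTypeR R)%type.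
Notation leb3s := (prod_sigma_finite (prod_sigma_finite leb leb) leb).

(** * Dilations, tensor products and the scalar product in dimension three *)

Section vec3.
Context (R : realType).
Implicit Types (p q v : mvec3 R) (e k c : R).

Lemma scales_measure_vec3 v k : 0 < k ->
  scales_measure (@prod_sigma_finite _ _ _ _ R (prod_sigma_finite leb leb) leb)
    (fun q : mvec3 R => v + k *: q) (k ^+ 3).
Proof.
move=> k0; have sk c := scales_measure_lebesgue c k0.
have k0' := ltW k0.
have := scales_measure_prod (mulr_ge0 k0' k0') k0'
  (scales_measure_prod k0' k0' (sk v.1.1) (sk v.1.2)) (sk v.2).
by rewrite exprSr expr2.
Qed.

Definition prod3 (u : R -> R) (q : vec3 R) := u q.1.1 * u q.1.2 * u q.2.

Lemma integrable_prod3 (u : R -> R) : leb.-integrable setT (EFin \o u) ->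
  leb3s.-integrable setT (EFin \o prod3 u).
Proof. by move=> iu; exact: integrable_tensor (integrable_tensor iu iu) iu. Qed.

Lemma Rintegral_prod3 (u : R -> R) : leb.-integrable setT (EFin \o u) ->
  \int[leb3s]_q prod3 u q = (\int[leb]_x u x) ^+ 3.
Proof.
move=> iu.
rewrite (Rintegral_tensor (integrable_tensor iu iu) iu).
by rewrite (Rintegral_tensor iu iu) exprSr expr2.
Qed.

(** The phase is a sum of three one-variable phases, so the product rule is applied twice. *)
Lemma cos_integral_laplace3 e (t : vec3 R) : 0 < e ->
  cos_integral leb3s (prod3 (laplace e)) (dot3 t)
    (prod3 (fun s => 2 * e / (e ^+ 2 + s ^+ 2)) t).
Proof.
move=> e0; have il := integrable_laplace e0.
have mt (s : R) : measurable_fun setT (fun x : measurableTypeR R => s * x).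
  exact: measurable_funM.
have h s := cos_integral_laplace s e0.
have h2 := cos_integral_prod il il (mt t.1.1) (mt t.1.2) (h _) (h _).
apply: (cos_integral_prod (integrable_tensor il il) il _ (mt t.2) h2 (h _)).
by apply: measurable_funD; apply: measurableT_comp.
Qed.

Lemma dot3C (p q : vec3 R) : dot3 p q = dot3 q p.
Proof. by rewrite /dot3; ring. Qed.

Lemma dot3Zl k (p q : vec3 R) : dot3 (k *: p) q = k * dot3 p q.
Proof. by rewrite /dot3 /= /GRing.scale /=; ring. Qed.

Lemma dot3Bl (p p' q : vec3 R) : dot3 (p - p') q = dot3 p q - dot3 p' q.
Proof. by rewrite /dot3 /=; ring. Qed.

Lemma measurable_dot3 : measurable_fun setT (fun z : mvec3 R * mvec3 R =>
  (dot3 z.1 z.2 : measurableTypeR R)).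
Proof.
have m11 : measurable_fun setT (fun z : mvec3 R => z.1.1).
  by apply: measurableT_comp => //; exact: measurable_fst.
have m12 : measurable_fun setT (fun z : mvec3 R => z.1.2).
  by apply: measurableT_comp => //; exact: measurable_snd.
have m2 : measurable_fun setT (fun z : mvec3 R => z.2).
  exact: measurable_snd.
have mp (i : mvec3 R -> measurableTypeR R) : measurable_fun setT i ->
    measurable_fun setT (fun z : mvec3 R * mvec3 R => i z.1 * i z.2).
  by move=> mi; apply: measurable_funM; exact: measurableT_comp.
apply: measurable_funD (mp _ m2).
exact: measurable_funD (mp _ m11) (mp _ m12).
Qed.

End vec3.

(** * Fourier inversion *)

Lemma measurable_prod3 (R : realType) (u : R -> R) :
  measurable_fun setT (u : measurableTypeR R -> measurableTypeR R) ->
  measurable_fun setT (prod3 u : mvec3 R -> measurableTypeR R).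
Proof.
move=> mu.
have m1 (i : measurableTypeR R * measurableTypeR R -> measurableTypeR R) :
    measurable_fun setT i ->
    measurable_fun setT (fun z : mvec3 R => u (i z.1)).
  move=> mi; apply: measurableT_comp mu _.
  by apply: measurableT_comp mi _; exact: measurable_fst.
apply: measurable_funM; last first.
  by apply: measurableT_comp mu _; exact: measurable_snd.
by apply: measurable_funM; apply: m1; [exact: measurable_fst|
  exact: measurable_snd].
Qed.

Lemma prod3_bounds (R : realType) (u : R -> R) (M : R) (q : vec3 R) :
  (forall x, 0 <= u x <= M) -> 0 <= prod3 u q <= M ^+ 3.
Proof.
move=> uM; rewrite /prod3.
have /andP[a0 a1] := uM q.1.1; have /andP[b0 b1] := uM q.1.2.
have /andP[c0 c1] := uM q.2.
by rewrite !mulr_ge0//= exprSr expr2 !ler_pM// mulr_ge0.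
Qed.

Section fourier_inversion.
Context (R : realType) (g phi : mvec3 R -> R).
Let C : R := (2 * pi) ^+ 3.
Hypotheses (ig : leb3s.-integrable setT (EFin \o g))
  (g01 : forall x, 0 <= g x <= 1) (cg : continuous (g : vec3 R -> R))
  (phi_ge0 : forall p, 0 <= phi p)
  (gphi : forall p, cos_integral leb3s g (dot3 p) (C * phi p)).

Let C_gt0 : 0 < C.
Proof. by rewrite exprn_gt0// mulr_gt0// pi_gt0. Qed.

Let mg : measurable_fun setT g.
Proof. by apply/measurable_EFinP; case/integrableP: ig. Qed.

Let phiE p : phi p = C^-1 * \int[leb3s]_eta (g eta * cos (dot3 p eta)).
Proof.
have := gphi p 0; rewrite cos0 mulr1.
under eq_Rintegral do rewrite addr0.
by move=> ->; rewrite mulKf// gt_eqF.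
Qed.

Let mcosdot (p : mvec3 R) c :
  measurable_fun setT (fun eta : mvec3 R => cos (dot3 p eta + c)).
Proof.
apply: measurableT_comp; first exact: measurable_fun_cos.
apply: measurable_funD => //.
exact: measurableT_comp (@measurable_dot3 R) (pair1_measurable p).
Qed.

Let igcos p c :
  leb3s.-integrable setT (EFin \o (fun eta => g eta * cos (dot3 p eta + c))).
Proof.
exact: integrable_Mbounded ig (mcosdot p c) (fun x => normr_cos_le1 _).
Qed.

(** Adding [g] makes the integrand [g (1 + cos)] nonnegative; Tonelli gives measurability in [p],
    and the constant integral of [g] is subtracted afterwards. *)
Lemma measurable_inverse_fourier : measurable_fun setT phi.
Proof.
pose h (z : mvec3 R * mvec3 R) := (g z.2 * (1 + cos (dot3 z.1 z.2)))%:E.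
have mh : measurable_fun setT h.
  apply/measurable_EFinP/measurable_funM; first exact: measurableT_comp.
  apply: measurable_funD => //; apply: measurableT_comp (@measurable_dot3 R).
  exact: measurable_fun_cos.
have h0 z : (0 <= h z)%E.
  have /andP[g0 _] := g01 z.2.
  by rewrite lee_fin mulr_ge0//.
have mF := measurable_fun_fubini_tonelli_F (m2 := leb3s) h mh h0.
have -> : phi = fun p => C^-1 *
    (fine (fubini_F leb3s h p) - \int[leb3s]_eta g eta).
  apply/funext => p; rewrite phiE; congr (_ * _).
  have -> : fine (fubini_F leb3s h p) =
      \int[leb3s]_eta (g eta + g eta * cos (dot3 p eta)).
    by apply: eq_Rintegral => eta _ /=; rewrite mulrDr mulr1.
  have := igcos p 0; under [X in EFin \o X]eq_fun do rewrite addr0.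
  by move=> igc; rewrite RintegralD// addrAC subrr add0r.
apply: measurable_funM => //; apply: measurable_funB => //.
by apply: measurableT_comp mF; exact: fine_measurable.
Qed.

Lemma inverse_fourier_le p : phi p <= C^-1 * \int[leb3s]_eta g eta.
Proof.
rewrite phiE ler_pM2l ?invr_gt0//.
have := igcos p 0; under [X in EFin \o X]eq_fun do rewrite addr0.
move=> igc; apply: le_Rintegral => // x _.
have /andP[g0 _] := g01 x.
by rewrite -[leRHS]mulr1 ler_wpM2l// cos_le1.
Qed.

Let integrable_regularized e eta0 c : 0 < e -> leb3s.-integrable setT
  (EFin \o (fun q => prod3 (laplace e) q * (phi q * cos (dot3 q eta0 + c)))).
Proof.
move=> e0; apply: (@integrable_Mbounded _ _ _ _ _ _
  (C^-1 * \int[leb3s]_eta g eta) (integrable_prod3 (integrable_laplace e0))).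
  apply: measurable_funM; first exact: measurable_inverse_fourier.
  have -> : (fun q => cos (dot3 q eta0 + c)) = (fun q => cos (dot3 eta0 q + c)).
    by apply/funext => q; rewrite dot3C.
  exact: mcosdot.
move=> q; rewrite normrM ger0_norm// -[leRHS]mulr1.
by rewrite ler_pM// ?inverse_fourier_le// normr_cos_le1.
Qed.

(** The Poisson average of [g] around [eta0] at scale [e], times the total mass [C] of the
    kernel. *)
Let poisson e eta0 :=
  \int[leb3s]_xi (g (eta0 + e *: xi) * prod3 (@cauchy R) xi).

(** With [phi] replaced by its Fourier integral and the integrals exchanged, the integral over [q]
    is the Poisson kernel at [eta - eta0]; the substitution [eta = eta0 + e xi] concludes. *)
Let regularized e eta0 c : 0 < e ->
  \int[leb3s]_q (prod3 (laplace e) q * (phi q * cos (dot3 q eta0 + c))) =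
  C^-1 * poisson e eta0 * cos c.
Proof.
move=> e0.
have il := integrable_prod3 (integrable_laplace e0).
have mw : measurable_fun setT (fun z : mvec3 R * mvec3 R =>
    dot3 z.1 z.2 - (dot3 z.1 eta0 + c)).
  apply: measurable_funB; first exact: measurable_dot3.
  apply: measurable_funD => //.
  have mz : measurable_fun setT (fun z : mvec3 R * mvec3 R => (z.1, eta0)).
    exact: measurable_fun_pair.
  exact: measurableT_comp (@measurable_dot3 R) mz.
apply: (@mulfI _ C); first by rewrite gt_eqF.
rewrite -RintegralZl//; last exact: integrable_regularized.
(* [gphi] is used with the phase [- (dot3 q eta0 + c)], which absorbs the outer cosine into the
   integral over [eta]. *)
transitivity (\int[leb3s]_q (prod3 (laplace e) q *
    \int[leb3s]_eta (g eta * cos (dot3 q eta - (dot3 q eta0 + c))))).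
  by apply: eq_Rintegral => q _; rewrite gphi cosN; ring.
rewrite (Rintegral_cos_swap il ig mw) /=.
have iP : leb3s.-integrable setT (EFin \o (fun eta : mvec3 R =>
    g eta * prod3 (@cauchy R) (e^-1 *: (eta - eta0)))).
  apply: (@integrable_Mbounded _ _ _ _ _ _ (2 ^+ 3) ig) => [|eta].
    have ev0 : 0 < e^-1 by rewrite invr_gt0.
    have mT := (scales_measure_vec3 (- (e^-1 *: eta0)) ev0).1.
    have -> : (fun eta : mvec3 R => prod3 (@cauchy R) (e^-1 *: (eta - eta0))) =
        prod3 (@cauchy R) \o (fun eta => - (e^-1 *: eta0) + e^-1 *: eta).
      by apply/funext => eta /=; rewrite scalerBr addrC.
    apply: measurableT_comp mT; apply: measurable_prod3.
    exact: measurable_cauchy.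
  have /andP[P0 P8] := prod3_bounds (e^-1 *: (eta - eta0)) (@cauchy_bounds R).
  by rewrite ger0_norm.
transitivity (\int[leb3s]_eta (e ^- 3 * cos c *
    (g eta * prod3 (@cauchy R) (e^-1 *: (eta - eta0))))).
  apply: eq_Rintegral => eta _.
  have := cos_integral_laplace3 (eta - eta0) e0 (- c).
  rewrite cosN => E.
  rewrite (_ : \int[_]_x _ = prod3 (fun s => 2 * e / (e ^+ 2 + s ^+ 2))
      (eta - eta0) * cos c); last first.
    rewrite -E; apply: eq_Rintegral => q _; congr (_ * cos _).
    by rewrite dot3Bl !(dot3C q) opprD addrA.
  rewrite [RHS]mulrCA; congr (_ * _).
  rewrite [RHS]mulrAC; congr (_ * _).
  rewrite /prod3 /cauchy /= /GRing.scale /=.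
  move: (eta.1.1 - _) (eta.1.2 - _) (eta.2 - _) => x y z.
  have q0 (t : R) : e ^+ 2 + t ^+ 2 != 0.
    by rewrite gt_eqF// ltr_pwDl ?sqr_ge0 ?exprn_gt0.
  (* Each coordinate is a rescaled Cauchy kernel; the resulting factor [e^-3] cancels the Jacobian
     [e^3] below. *)
  have q1 (t : R) : 2 * e / (e ^+ 2 + t ^+ 2) =
      e^-1 * (2 / (1 + (e^-1 * t) ^+ 2)).
    have en0 : e != 0 by rewrite gt_eqF.
    by field; rewrite en0 q0.
  rewrite !q1 -exprVn; ring.
rewrite RintegralZl//.
rewrite (Rintegral_scales (exprn_gt0 3 e0) (scales_measure_vec3 eta0 e0) iP).
have -> : \int[leb3s]_xi (g (eta0 + e *: xi) *
    prod3 (@cauchy R) (e^-1 *: (eta0 + e *: xi - eta0))) = poisson e eta0.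
  apply: eq_Rintegral => xi _; congr (_ * prod3 _ _).
  by rewrite addrAC subrr add0r scalerA mulVf ?gt_eqF// scale1r.
have en0 : e ^+ 3 != 0 by rewrite gt_eqF// exprn_gt0.
have Cn0 : C != 0 by rewrite gt_eqF.
by field; rewrite Cn0 gt_eqF.
Qed.

Let e_ (n : nat) : R := harmonic n.

Let e_gt0 n : 0 < e_ n.
Proof. by rewrite /e_ /harmonic invr_gt0. Qed.

Let cvg_e : e_ n @[n --> \oo] --> (0 : R).
Proof. exact: cvg_harmonic. Qed.

Let integrable_cauchy3 : leb3s.-integrable setT (EFin \o prod3 (@cauchy R)).
Proof. exact/integrable_prod3/integrable_cauchy. Qed.

(** The integrand converges by continuity of [g] at [eta0] and is dominated by the Cauchy kernel,
    since [g <= 1]. *)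
Let cvg_poisson eta0 : C^-1 * poisson (e_ n) eta0 @[n --> \oo] --> g eta0.
Proof.
have IC : \int[leb3s]_xi (g eta0 * prod3 (@cauchy R) xi) = g eta0 * C.
  by rewrite RintegralZl// Rintegral_prod3 ?Rintegral_cauchy//;
    exact: integrable_cauchy.
rewrite -[g eta0](@mulfK _ C) ?gt_eqF// -IC mulrC.
apply: cvgM; first exact: cvg_cst.
apply: (@cvg_Rintegral_dominated _ (mvec3 R) R leb3s
  (fun n xi => g (eta0 + e_ n *: xi) * prod3 (@cauchy R) xi)
  (fun xi => g eta0 * prod3 (@cauchy R) xi) (prod3 (@cauchy R))) => //.
- move=> n; apply: measurable_funM.
    exact: measurableT_comp mg (scales_measure_vec3 eta0 (e_gt0 n)).1.
  apply: measurable_prod3; exact: measurable_cauchy.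
- move=> xi; apply: cvgM; last exact: cvg_cst.
  have c0 : (e_ n *: (xi : vec3 R)) @[n --> \oo] --> (0 : vec3 R).
    rewrite -[X in _ --> X](scale0r (xi : vec3 R)).
    by apply: cvgZr_tmp; exact: cvg_e.
  have ce : ((eta0 : vec3 R) + e_ n *: (xi : vec3 R)) @[n --> \oo] -->
      (eta0 : vec3 R).
    by rewrite -[X in _ --> X]addr0; apply: cvgD => //; exact: cvg_cst.
  exact: cvg_comp ce (@cg eta0).
- move=> n xi; have /andP[P0 _] := prod3_bounds xi (@cauchy_bounds R).
  have /andP[g0 g1] := g01 (eta0 + e_ n *: xi).
  by rewrite normrM !ger0_norm// -[leRHS]mul1r ler_wpM2r.
Qed.

Let cvg_laplace q : prod3 (laplace (e_ n)) q @[n --> \oo] --> (1 : R).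
Proof.
have cl (x : R) : laplace (e_ n) x @[n --> \oo] --> (1 : R).
  rewrite -(@expR0 R) -oppr0 -(mul0r `|x|).
  have c0 : - (e_ n * `|x|) @[n --> \oo] --> - (0 * `|x|).
    by apply: cvgN; apply: cvgM => //; exact: cvg_cst.
  exact: cvg_comp c0 (@continuous_expR R _).
have -> : (1 : R) = 1 * 1 * 1 by rewrite !mulr1.
by apply: cvgM; [apply: cvgM|]; exact: cl.
Qed.

Let laplace_bounds e (x : R) : 0 < e -> 0 <= laplace e x <= 1.
Proof.
move=> e0; rewrite expR_ge0/= /laplace -expR0 ler_expR oppr_le0.
by rewrite mulr_ge0 // ltW.
Qed.

Lemma integrable_inverse_fourier : leb3s.-integrable setT (EFin \o phi).
Proof.
pose psi n (q : mvec3 R) := (prod3 (laplace (e_ n)) q * phi q)%:E.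
have lp n q : 0 <= prod3 (laplace (e_ n)) q <= 1.
  by rewrite -(expr1n R 3); apply: prod3_bounds => x; exact: laplace_bounds.
have psi0 n q : setT q -> (0 <= psi n q)%E.
  by move=> _; rewrite lee_fin mulr_ge0//; have /andP[] := lp n q.
have mphi := measurable_inverse_fourier.
have mpsi n : measurable_fun setT (psi n).
  apply/measurable_EFinP; apply: measurable_funM => //.
  by apply: measurable_prod3; exact: measurable_laplace.
(* The scales [e_ n] decrease, hence the damping factors increase with [n]. *)
have psi_nd q : setT q -> {homo psi^~ q : n m / (n <= m)%N >-> (n <= m)%E}.
  move=> _ n m nm; rewrite lee_fin ler_wpM2r//.
  have ll (x : R) : laplace (e_ n) x <= laplace (e_ m) x.
    rewrite ler_expR lerN2 ler_wpM2r//.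
    by rewrite /e_ /harmonic lef_pV2 ?posrE// ler_nat.
  have l0 k (x : R) : 0 <= laplace (e_ k) x by exact: expR_ge0.
  by rewrite /prod3 !ler_pM// mulr_ge0.
have psilim q : limn (psi^~ q) = (phi q)%:E.
  apply/cvg_lim => //; apply: cvg_EFin; first exact: nearW.
  rewrite -[X in _ --> X]mul1r.
  by apply: cvgM; [exact: cvg_laplace|exact: cvg_cst].
(* This is [regularized] at frequency 0 and phase 0, where the cosine is 1. *)
have Ipsi n : (\int[leb3s]_q psi n q = (C^-1 * poisson (e_ n) 0)%:E)%E.
  have := integrable_regularized 0 0 (e_gt0 n).
  have := regularized 0 0 (e_gt0 n); rewrite cos0 mulr1 => <- ireg.
  rewrite /Rintegral fineK; last exact: integrable_fin_num.
  apply: eq_integral => q _; rewrite /psi.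
  rewrite dot3C (_ : dot3 0 q = 0) ?addr0 ?cos0 ?mulr1//.
  by rewrite /dot3 /= !mul0r !addr0.
have c1 : (\int[leb3s]_q psi n q)%E @[n --> \oo] -->
    (\int[leb3s]_q (phi q)%:E)%E.
  have -> : (\int[leb3s]_q (phi q)%:E = \int[leb3s]_q limn (psi^~ q))%E.
    by apply: eq_integral => q _; rewrite psilim.
  exact: cvg_monotone_convergence.
have c2 : (\int[leb3s]_q psi n q)%E @[n --> \oo] --> (g 0)%:E.
  under eq_fun do rewrite Ipsi.
  by apply: cvg_EFin; [exact: nearW|exact: cvg_poisson].
(* The integral of [phi] equals the finite number [g 0]. *)
have E := cvg_unique (@ereal_hausdorff R) c2 c1.
apply/integrableP; split; first exact/measurable_EFinP.
under eq_integral do rewrite /= ger0_norm//.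
by rewrite -E ltry.
Qed.

(** The damped integrals have two limits: one by domination by the now integrable [phi], the other
    by convergence of the Poisson averages. *)
Lemma cos_integral_inverse_fourier eta :
  cos_integral leb3s phi (dot3 eta) (g eta).
Proof.
move=> c.
have iphi := integrable_inverse_fourier.
have c1 : \int[leb3s]_q (prod3 (laplace (e_ n)) q *
    (phi q * cos (dot3 q eta + c))) @[n --> \oo] -->
    \int[leb3s]_q (1 * (phi q * cos (dot3 q eta + c))).
  apply: (@cvg_Rintegral_dominated _ (mvec3 R) R leb3s
    (fun n q => prod3 (laplace (e_ n)) q * (phi q * cos (dot3 q eta + c)))
    (fun q => 1 * (phi q * cos (dot3 q eta + c))) phi) => //.
  - move=> n; have := integrable_regularized eta c (e_gt0 n).
    by case/integrableP => /measurable_EFinP.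
  - move=> q; apply: cvgM; [exact: cvg_laplace|exact: cvg_cst].
  - move=> n q.
    have /andP[l0 l1] : 0 <= prod3 (laplace (e_ n)) q <= 1.
      by rewrite -(expr1n R 3); apply: prod3_bounds => x; exact: laplace_bounds.
    rewrite normrM (ger0_norm l0) normrM (ger0_norm (phi_ge0 q)).
    rewrite -[leRHS]mul1r; apply: ler_pM => //; first by rewrite mulr_ge0.
    by rewrite -[leRHS]mulr1; apply: ler_wpM2l => //; exact: normr_cos_le1.
have c2 : \int[leb3s]_q (prod3 (laplace (e_ n)) q *
    (phi q * cos (dot3 q eta + c))) @[n --> \oo] --> g eta * cos c.
  under eq_fun do rewrite regularized//.
  by apply: cvgM; [exact: cvg_poisson|exact: cvg_cst].
rewrite (cvg_unique (@Rhausdorff R) c2 c1).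
by apply: eq_Rintegral => q _; rewrite mul1r dot3C.
Qed.

End fourier_inversion.

(** * Convolution of inverse Fourier transforms *)

Lemma measurable_sub3 (R : realType) :
  measurable_fun setT (fun z : mvec3 R * mvec3 R => (z.1 - z.2 : mvec3 R)).
Proof.
have m11 : measurable_fun setT (fun z : mvec3 R => z.1.1).
  by apply: measurableT_comp => //; exact: measurable_fst.
have m12 : measurable_fun setT (fun z : mvec3 R => z.1.2).
  by apply: measurableT_comp => //; exact: measurable_snd.
have m2 : measurable_fun setT (fun z : mvec3 R => z.2).
  exact: measurable_snd.
have mp (i : mvec3 R -> measurableTypeR R) : measurable_fun setT i ->
    measurable_fun setT (fun z : mvec3 R * mvec3 R => i z.1 - i z.2).
  by move=> mi; apply: measurable_funB; exact: measurableT_comp.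
apply: measurable_fun_pair (mp _ m2).
exact: measurable_fun_pair (mp _ m11) (mp _ m12).
Qed.

Section convolution.
Context (R : realType) (g1 g2 phi1 phi2 phi3 : mvec3 R -> R).
Let C : R := (2 * pi) ^+ 3.
Hypotheses (iphi1 : leb3s.-integrable setT (EFin \o phi1))
  (ig2 : leb3s.-integrable setT (EFin \o g2))
  (hphi1 : forall eta, cos_integral leb3s phi1 (dot3 eta) (g1 eta))
  (hg2 : forall p, cos_integral leb3s g2 (dot3 p) (C * phi2 p))
  (hg12 : forall p, cos_integral leb3s (fun eta => g1 eta * g2 eta) (dot3 p)
     (C * phi3 p))
  (mphi2 : measurable_fun setT phi2)
  (B : R) (phi2B : forall p, 0 <= phi2 p <= B).

Lemma integrable_convolution p :
  leb3s.-integrable setT (EFin \o (fun q => phi1 q * phi2 (p - q))).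
Proof.
apply: (integrable_Mbounded iphi1 (M := B)).
  apply: measurableT_comp mphi2 _.
  exact: measurableT_comp (@measurable_sub3 R) (pair1_measurable p).
by move=> q; have /andP[? ?] := phi2B (p - q); rewrite ger0_norm.
Qed.

(** Writing [phi2 (p - q)] as a Fourier integral of [g2] and exchanging the integrals, the integral
    over [q] restores [g1]; what remains is the transform of [g1 g2]. *)
Lemma Rintegral_convolution p :
  \int[leb3s]_q (phi1 q * phi2 (p - q)) = phi3 p.
Proof.
have C0 : C != 0 by rewrite gt_eqF// exprn_gt0// mulr_gt0// pi_gt0.
apply: (@mulfI _ C) => //; rewrite -RintegralZl//; last first.
  exact: integrable_convolution.
transitivity (\int[leb3s]_q (phi1 q *
    \int[leb3s]_eta (g2 eta * cos (dot3 (p - q) eta)))).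
  apply: eq_Rintegral => q _.
  have := hg2 (p - q) 0; rewrite cos0 mulr1.
  by under eq_Rintegral do rewrite addr0; move=> ->; rewrite mulrCA.
have mw : measurable_fun setT (fun z : mvec3 R * mvec3 R =>
    dot3 (p - z.1) z.2).
  have m1 : measurable_fun setT (fun z : mvec3 R * mvec3 R => (p - z.1, z.2)).
    have ms : measurable_fun setT (fun q : mvec3 R => p - q).
      exact: measurableT_comp (@measurable_sub3 R) (pair1_measurable p).
    apply: measurable_fun_pair => //.
    exact: measurableT_comp ms measurable_fst.
  exact: measurableT_comp (@measurable_dot3 R) m1.
rewrite (Rintegral_cos_swap iphi1 ig2 mw) /=.
transitivity (\int[leb3s]_eta (g1 eta * g2 eta * cos (dot3 p eta + 0))).
  apply: eq_Rintegral => eta _.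
  rewrite (_ : \int[_]_x _ = g1 eta * cos (dot3 p eta)).
    by rewrite addr0 mulrCA mulrA.
  (* [hphi1] is used with the phase [- dot3 p eta]. *)
  rewrite -(cosN (dot3 p eta)) -hphi1; apply: eq_Rintegral => q _.
  by rewrite -cosN dot3Bl opprB (dot3C q).
by rewrite hg12 cos0 mulr1.
Qed.

End convolution.

(** * Homogeneity and dilations *)

Lemma homogeneous_ge0 (R : realType) (kappa : R) (b : mvec3 R -> R) :
  continuous (b : vec3 R -> R) ->
  (forall (l : R) (eta : vec3 R), 0 < l -> b (l *: eta) = l `^ kappa * b eta) ->
  leb3s.-integrable setT (fun eta => (expR (- b eta))%:E) ->
  forall eta, 0 <= b eta.
Proof.
move=> cb hb ig eta0; rewrite leNgt; apply/negP => b0.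
have : \forall x \near (eta0 : vec3 R), b x < 0.
  exact: (cvgr_lt _ (cb eta0)).
move=> /nbhs_ballP[r /= r0 br].
(* Balls of the product norm are boxes, so [B] is the ball of radius [r] around [eta0]. *)
pose B : set (mvec3 R) :=
  (ball eta0.1.1 r `*` ball eta0.1.2 r) `*` ball eta0.2 r.
have mB1 (x : R) : measurable (ball x r : set (measurableTypeR R)).
  exact: measurable_ball.
have mB : measurable B by do 2 apply: measurableX => //.
have bB eta : B eta -> b eta < 0.
  by move=> [[? ?] ?]; apply: br.
have mg : measurable_fun setT (fun eta => (expR (- b eta))%:E).
  by case/integrableP: ig.
pose I : R := \int[leb3s]_eta expR (- b eta).
have I0 : 0 <= I by apply: Rintegral_ge0 => x _; exact: expR_ge0.
pose m : R := (r *+ 2) * (r *+ 2) * (r *+ 2).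
have m0 : 0 < m by rewrite !mulr_gt0// mulrn_wgt0.
have vB : leb3s B = m%:E.
  have lb (x : R) : leb (ball x r) = (r *+ 2)%:E.
    exact: lebesgue_measure_ball (ltW r0).
  transitivity (leb (ball eta0.1.1 r) * leb (ball eta0.1.2 r) *
      leb (ball eta0.2 r))%E; last by rewrite !lb.
  rewrite /= product_measure1E//; last exact: measurableX.
  by congr (_ * _)%E; rewrite /= product_measure1E.
(* With this choice [l m = m + I > I], while [l >= 1] gives [l <= l^3]. *)
pose l : R := 1 + I / m.
have l1 : 1 <= l by rewrite lerDl divr_ge0// ltW.
have l0 : 0 < l by apply: lt_le_trans l1.
have : l ^+ 3 * m <= I.
  rewrite -lee_fin /I /Rintegral fineK; last exact: integrable_fin_num.
  pose h := fun eta : mvec3 R => (expR (- b (0 + l *: eta)))%:E.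
  have mh : measurable_fun setT h.
    exact: measurableT_comp mg (scales_measure_vec3 0 l0).1.
  have h0 eta : (0 <= h eta)%E by rewrite lee_fin expR_ge0.
  (* By homogeneity [b (l eta)] is nonpositive on [B], so [h >= 1] there. *)
  have mBh : (m%:E <= \int[leb3s]_(eta in B) h eta)%E.
    rewrite -vB -[leLHS]mul1e -integral_cst//.
    apply: ge0_le_integral => //; first exact: measurable_funTS.
    move=> x Bx; rewrite lee_fin add0r hb// -expR0 ler_expR oppr_ge0.
    by rewrite mulr_ge0_le0 ?powR_ge0// ltW// bB.
  have hT : (\int[leb3s]_(eta in B) h eta <= \int[leb3s]_eta h eta)%E.
    exact: ge0_subset_integral.
  rewrite (ge0_integral_scales (exprn_gt0 3 l0) (scales_measure_vec3 0 l0) mg).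
    rewrite EFinM; apply: lee_wpmul2l; first by rewrite lee_fin exprn_ge0// ltW.
    exact: le_trans mBh hT.
  by move=> x; rewrite lee_fin expR_ge0.
rewrite leNgt => /negP; apply.
have : I < l * m by rewrite mulrDl mul1r divfK ?gt_eqF// ltrDr.
move/lt_le_trans; apply; rewrite ler_pM2r//.
by rewrite ler_eXnr.
Qed.

Lemma cos_integral_dilation (R : realType) (g phi : mvec3 R -> R) (C k : R)
    (p : mvec3 R) : 0 < k ->
  leb3s.-integrable setT (EFin \o g) ->
  (forall p, cos_integral leb3s g (dot3 p) (C * phi p)) ->
  cos_integral leb3s (fun eta => g (k *: eta)) (dot3 p)
    (C * (k ^- 3 * phi (k^-1 *: p))).
Proof.
move=> k0 ig gphi c.
have k3 : k ^+ 3 != 0 by rewrite gt_eqF// exprn_gt0.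
have mc : measurable_fun setT
    (fun eta : mvec3 R => cos (dot3 (k^-1 *: p) eta + c)).
  apply: measurableT_comp; first exact: measurable_fun_cos.
  apply: measurable_funD => //.
  exact: measurableT_comp (@measurable_dot3 R) (pair1_measurable _).
have igc := integrable_Mbounded ig mc (fun eta => normr_cos_le1 _).
have := Rintegral_scales (exprn_gt0 3 k0) (scales_measure_vec3 0 k0) igc.
rewrite gphi => E; apply: (@mulfI _ (k ^+ 3)) => //.
transitivity (C * phi (k^-1 *: p) * cos c); last by field; rewrite gt_eqF.
rewrite E; congr (_ * _); apply: eq_Rintegral => eta _ /=.
rewrite add0r dot3Zl (dot3C p (k *: eta)) dot3Zl mulKf ?gt_eqF//.
by rewrite dot3C.
Qed.

(** * Integrating out the momentum against a kernel of constant mass *)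

Section mixture.
Context d1 d2 (T1 : measurableType d1) (T2 : measurableType d2) (R : realType)
  (m1 : {sigma_finite_measure set T1 -> \bar R})
  (m2 : {sigma_finite_measure set T2 -> \bar R}).
Context (E : set T2) (G : T2 -> R) (K : T1 * T2 -> R) (k : R).
Hypotheses (mE : measurable E) (iG : m2.-integrable E (EFin \o G))
  (mK : measurable_fun setT K) (K_ge0 : forall x y, E y -> 0 <= K (x, y))
  (iK : forall y, E y -> m1.-integrable setT (EFin \o (fun x => K (x, y))))
  (IK : forall y, E y -> \int[m1]_x K (x, y) = k).

(** Extending [G] by 0 removes the values of [K] outside [E], where its sign and mass are not
    controlled, and reduces to integrals over the whole product. *)
Let GE : T2 -> R := G \_ E.

Let iGE : m2.-integrable setT (EFin \o GE).
Proof.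
by move/(integrable_mkcond _ mE) : iG; rewrite restrict_EFin.
Qed.

Let H (z : T1 * T2) := GE z.2 * K z.

Let HE : (fun z => (G z.2 * K z)%:E) \_ (setT `*` E) = EFin \o H.
Proof.
apply/funext => -[x y]; rewrite /patch /H /GE /= /patch.
rewrite (_ : ((x, y) \in setT `*` E) = (y \in E)); last first.
  by apply/idP/idP; rewrite !inE => // -[].
by case: ifPn; rewrite ?mul0r.
Qed.

(** Tonelli with the first variable integrated first: as [K >= 0] has mass [k], the inner integral
    of the absolute value is [|k G|]. *)
Let iH : (prod_sigma_finite m1 m2).-integrable setT (EFin \o H).
Proof.
have mGE : measurable_fun setT GE.
  by apply/measurable_EFinP; case/integrableP: iGE.
have mH : measurable_fun setT (EFin \o H).
  apply/measurable_EFinP; apply: measurable_funM => //.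
  exact: measurableT_comp mGE measurable_snd.
apply/(integrable21ltyP m1 m2 mH).
have [_] := integrableP _ _ _ (integrableZl measurableT k iGE).
congr (_ < _)%E; apply: eq_integral => y _.
have [yE|yE] := boolP (y \in E).
  have Ey : E y by rewrite inE in yE.
  have I0 : 0 <= \int[m1]_x K (x, y).
    by apply: Rintegral_ge0 => x _; exact: K_ge0.
  rewrite /= normrM -(IK Ey) (ger0_norm I0).
  rewrite EFinM /Rintegral fineK; last exact/integrable_fin_num/iK.
  rewrite muleC -ge0_integralZl//.
  - apply: eq_integral => x _.
    by rewrite /H /= normrM EFinM (ger0_norm (K_ge0 _ Ey)).
  - by have /integrableP[] := iK Ey.
  - by move=> x _; rewrite lee_fin K_ge0.
rewrite /= /H /GE /= /patch (negbTE yE) mulr0 normr0.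
by rewrite integral0_eq// => x _; rewrite /= mul0r normr0.
Qed.

Lemma integrable_mixture : (m1 \x m2)%E.-integrable (setT `*` E)
  (fun z => (G z.2 * K z)%:E).
Proof.
apply/(integrable_mkcond (mu := (m1 \x m2)%E)); first exact: measurableX.
by rewrite HE; exact: iH.
Qed.

Lemma Rintegral_mixture : \int[m1]_x \int[m2]_(y in E) (G y * K (x, y)) =
  k * \int[m2]_(y in E) G y.
Proof.
transitivity (\int[m1]_x \int[m2]_y H (x, y)).
  apply: eq_Rintegral => x _; rewrite Rintegral_mkcond.
  apply: eq_Rintegral => y _; rewrite /H /GE /= /patch.
  by case: ifPn; rewrite ?mul0r.
rewrite (Rintegral_Fubini iH) [in RHS]Rintegral_mkcond.
rewrite -(RintegralZl k measurableT iGE).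
apply: eq_Rintegral => y _; rewrite /H /=.
have [yE|yE] := boolP (y \in E).
  have Ey : E y by rewrite inE in yE.
  by rewrite RintegralZl ?IK 1?mulrC//; exact: iK.
rewrite /GE /= /patch (negbTE yE) mulr0.
under eq_Rintegral do rewrite mul0r.
by rewrite Rintegral_cst// mul0r.
Qed.

End mixture.

(** * The momentum densities *)

(** A real value of the transform means that the sine integral vanishes; the addition formula then
    gives every phase [c]. *)
Lemma cos_integral_inv_fourier (R : realType) (psi : vec3 R -> R)
    (p : vec3 R) (r : R) :
  leb3s.-integrable setT (EFin \o (psi : mvec3 R -> R)) ->
  r%:C%C = inv_fourier3 psi p ->
  cos_integral leb3s (psi : mvec3 R -> R) (dot3 p) ((2 * pi) ^+ 3 * r).
Proof.
have C0 : (2 * pi) ^+ 3 != 0 :> R.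
  by rewrite gt_eqF// exprn_gt0// mulr_gt0// pi_gt0.
move=> ipsi [rE /esym/eqP].
rewrite mulf_eq0 invr_eq0 (negbTE C0) => /eqP I0 c.
have mdot : measurable_fun setT (fun eta : mvec3 R => dot3 p eta).
  exact: measurableT_comp (@measurable_dot3 R) (pair1_measurable p).
have ic : leb3s.-integrable setT
    (EFin \o (fun eta : mvec3 R => psi eta * cos (dot3 p eta))).
  apply: integrable_Mbounded ipsi _ (fun x => normr_cos_le1 _).
  by apply: measurableT_comp mdot; exact: measurable_fun_cos.
have is_ : leb3s.-integrable setT
    (EFin \o (fun eta : mvec3 R => psi eta * sin (dot3 p eta))).
  apply: (@integrable_Mbounded _ _ _ _ _ _ 1 ipsi).
    apply: measurableT_comp mdot; apply: continuous_measurable_fun.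
    exact: continuous_sin.
  by move=> x; rewrite ler_norml sin_geN1 sin_le1.
transitivity (\int[leb3s]_eta (cos c * (psi eta * cos (dot3 p eta)) -
    sin c * (psi eta * sin (dot3 p eta)))).
  by apply: eq_Rintegral => eta _; rewrite cosD; ring.
rewrite RintegralB//.
- rewrite (RintegralZl (cos c) measurableT ic).
  rewrite (RintegralZl (sin c) measurableT is_).
  rewrite [X in _ - _ * X](_ : _ = 0); last exact: I0.
  by rewrite mulr0 subr0 mulrC rE mulrA mulfV ?mul1r.
- exact: (integrableZl measurableT (cos c) ic).
- exact: (integrableZl measurableT (sin c) is_).
Qed.

Lemma measurable_scale3 (R : realType) :
  measurable_fun setT
    (fun z : mvec3 R * measurableTypeR R => (z.2 *: z.1 : mvec3 R)).
Proof.
have m11 : measurable_fun setT (fun z : mvec3 R => z.1.1).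
  by apply: measurableT_comp => //; exact: measurable_fst.
have m12 : measurable_fun setT (fun z : mvec3 R => z.1.2).
  by apply: measurableT_comp => //; exact: measurable_snd.
have m2 : measurable_fun setT (fun z : mvec3 R => z.2).
  exact: measurable_snd.
have mp (i : mvec3 R -> measurableTypeR R) : measurable_fun setT i ->
    measurable_fun setT
      (fun z : mvec3 R * measurableTypeR R => z.2 * i z.1).
  move=> mi; apply: measurable_funM; first exact: measurable_snd.
  exact: measurableT_comp mi measurable_fst.
apply: measurable_fun_pair (mp _ m2).
exact: measurable_fun_pair (mp _ m11) (mp _ m12).
Qed.

Section momentum_density.
Context (R : realType) (theta : R) (b phi : vec3 R -> R).
Hypotheses (theta_gt0 : 0 < theta) (b_cont : continuous b)
  (b_homogeneous : forall (lambda : R) (eta : vec3 R), 0 < lambda ->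
     b (lambda *: eta) = lambda `^ theta^-1 * b eta)
  (expb_L1 : leb3s.-integrable setT (fun eta => (expR (- b eta))%:E))
  (phi_fourier : forall p : mvec3 R,
     cos_integral leb3s (fun eta => expR (- b eta)) (dot3 p)
       ((2 * pi) ^+ 3 * phi p))
  (phi_ge0 : forall p : vec3 R, 0 <= phi p).

(* [p |-> momentum_density m p] is the inverse Fourier transform of
   [exp (- m b)]; these form a convolution semigroup in [m]. *)
Definition momentum_density (m : R) (p : vec3 R) :=
  m `^ (- (3 * theta)) * phi ((m `^ theta)^-1 *: p).

Let C : R := (2 * pi) ^+ 3.
Let g (m : R) (eta : mvec3 R) : R := expR (- (m * b eta)).

(** Homogeneity at [m^theta] produces the factor [(m^theta)^(1/theta) = m]. *)
Let gE m : 0 < m -> g m = fun eta => expR (- b (m `^ theta *: eta)).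
Proof.
move=> m0; apply/funext => eta; rewrite b_homogeneous ?powR_gt0//.
by rewrite -powRrM mulfV ?gt_eqF// powRr1// ltW.
Qed.

Let b_ge0 eta : 0 <= b eta.
Proof. exact: homogeneous_ge0 b_cont b_homogeneous expb_L1 eta. Qed.

(** Homogeneity at the factor 2 gives [b 0 = 2^(1/theta) * b 0], and [2^(1/theta)] differs from
    1. *)
Let b0 : b 0 = 0.
Proof.
have := b_homogeneous 0 (ltr0n R 2); rewrite scaler0 => /eqP.
rewrite -subr_eq0 -{1}[b 0]mul1r -mulrBl mulf_eq0 subr_eq0 => /orP[|/eqP//].
rewrite eq_sym powR_eq1 pnatr_eq1 invr_eq0 (gt_eqF theta_gt0).
by rewrite ltNge ler0n.
Qed.

Let g01 m eta : 0 < m -> 0 <= g m eta <= 1.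
Proof.
move=> m0; rewrite expR_ge0/= /g -expR0 ler_expR oppr_le0.
by rewrite mulr_ge0// ltW.
Qed.

Let cg m : continuous (g m : vec3 R -> R).
Proof.
move=> x; apply: (@continuous_comp _ _ _ (fun y => - (m * b y)) expR);
  last exact: continuous_expR.
by apply: cvgN; apply: cvgM; [exact: cvg_cst|exact: b_cont].
Qed.

Let ig m : 0 < m -> leb3s.-integrable setT (EFin \o g m).
Proof.
move=> m0; rewrite gE//; have k0 : 0 < m `^ theta by exact: powR_gt0.
have := integrable_scales (exprn_gt0 3 k0) (scales_measure_vec3 0 k0) expb_L1.
congr (integrable _ _ _); apply/funext => eta /=.
by rewrite add0r.
Qed.

Let g_density m p : 0 < m ->
  cos_integral leb3s (g m) (dot3 p) (C * momentum_density m p).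
Proof.
move=> m0; rewrite gE//; have k0 : 0 < m `^ theta by exact: powR_gt0.
have -> : momentum_density m p =
    (m `^ theta) ^- 3 * phi ((m `^ theta)^-1 *: p).
  by rewrite /momentum_density powRN (mulrC 3) powRrM powR_mulrn ?powR_ge0.
exact: cos_integral_dilation k0 expb_L1 phi_fourier.
Qed.

Lemma momentum_density_ge0 m p : 0 <= momentum_density m p.
Proof. by rewrite mulr_ge0// powR_ge0. Qed.

Lemma integrable_momentum_density m : 0 < m ->
  leb3s.-integrable setT (EFin \o (momentum_density m : mvec3 R -> R)).
Proof.
move=> m0; apply: (integrable_inverse_fourier (ig m0)) => //.
- by move=> x; exact: g01.
- by move=> p; exact: momentum_density_ge0.
- by move=> p; exact: g_density.
Qed.

Let density_fourier m eta : 0 < m ->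
  cos_integral leb3s (momentum_density m : mvec3 R -> R) (dot3 eta) (g m eta).
Proof.
move=> m0; apply: (cos_integral_inverse_fourier (ig m0)) => //.
- by move=> x; exact: g01.
- by move=> p; exact: momentum_density_ge0.
- by move=> p; exact: g_density.
Qed.

(** The mass is the Fourier transform at frequency 0, namely [exp (- m b(0)) = 1]. *)
Lemma Rintegral_momentum_density m : 0 < m ->
  \int[leb3s]_p momentum_density m p = 1.
Proof.
move=> m0; have := density_fourier 0 m0 0.
rewrite /g b0 mulr0 oppr0 expR0 cos0 mulr1 => <-.
apply: eq_Rintegral => p _.
rewrite (_ : dot3 0 p = 0) ?addr0 ?cos0 ?mulr1//.
by rewrite /dot3 /= !mul0r !addr0.
Qed.

Let measurable_density m : 0 < m ->
  measurable_fun setT (momentum_density m : mvec3 R -> R).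
Proof.
move=> m0; apply: (measurable_inverse_fourier (ig m0)) => //.
- by move=> x; exact: g01.
- by move=> p; exact: g_density.
Qed.

Let density_bounds m p : 0 < m ->
  0 <= momentum_density m p <= C^-1 * \int[leb3s]_eta g m eta.
Proof.
move=> m0; rewrite momentum_density_ge0/=.
apply: (inverse_fourier_le (ig m0)) => [x|q]; first exact: g01.
exact: g_density.
Qed.

Lemma integrable_momentum_density_conv s t (p : vec3 R) : 0 < s -> 0 < t ->
  leb3s.-integrable setT (EFin \o (fun q : mvec3 R =>
    momentum_density s q * momentum_density t (p - q))).
Proof.
move=> s0 t0; apply: (integrable_convolution _ (measurable_density t0)).
  exact: integrable_momentum_density.
by move=> q; exact: density_bounds.
Qed.

(** On the Fourier side this is [exp (- s b) exp (- t b) = exp (- (s + t) b)]. *)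
Lemma momentum_density_conv s t (p : vec3 R) : 0 < s -> 0 < t ->
  \int[leb3s]_q (momentum_density s q * momentum_density t (p - q)) =
  momentum_density (s + t) p.
Proof.
move=> s0 t0.
apply: (@Rintegral_convolution _ (g s) (g t) _ _ (momentum_density (s + t))
  _ _ _ _ _ (measurable_density t0) _ (fun q => density_bounds q t0)).
- exact: integrable_momentum_density.
- exact: ig.
- by move=> eta; exact: density_fourier.
- by move=> q; exact: g_density.
- move=> q; have := g_density q (addr_gt0 s0 t0).
  congr (cos_integral _ _ _ _); apply/funext => eta.
  by rewrite /g mulrDl opprD expRD.
Qed.

(** Joint measurability in momentum and mass serves the double integrals of the ballistic equation.
    It reduces to that of [phi], the inverse transform of [g 1]. *)
Lemma measurable_momentum_density : measurable_fun setT
  (fun z : mvec3 R * measurableTypeR R => momentum_density z.2 z.1).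
Proof.
have mphi : measurable_fun setT (phi : mvec3 R -> R).
  have g1E : g 1 = fun eta => expR (- b eta).
    by apply/funext => eta; rewrite /g mul1r.
  apply: (measurable_inverse_fourier (g := g 1)).
  - exact: ig.
  - by move=> x; exact: g01.
  - by move=> q; rewrite g1E; exact: phi_fourier.
apply: measurable_funM.
  exact: measurableT_comp (measurable_powR _) measurable_snd.
apply: measurableT_comp mphi _.
have ms : measurable_fun setT (fun z : mvec3 R * measurableTypeR R =>
    (z.1, z.2 `^ (- theta))).
  apply: measurable_fun_pair => //.
  exact: measurableT_comp (measurable_powR _) measurable_snd.
have -> : (fun z : mvec3 R * measurableTypeR R => (z.2 `^ theta)^-1 *: z.1) =
    (fun z : mvec3 R * measurableTypeR R => z.2 *: z.1) \o
    (fun z : mvec3 R * measurableTypeR R => (z.1, z.2 `^ (- theta))).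
  by apply/funext => z /=; rewrite powRN.
exact: measurableT_comp (@measurable_scale3 R) ms.
Qed.

End momentum_density.

(** * From coagulation to ballistic aggregation *)

Theorem corollary3 (R : realType) (theta : R) (b phi : vec3 R -> R)
    (J : set R) (a : R -> R -> R) (F : R -> R -> R)
    (theta_gt0 : 0 < theta)
    (b_smooth : smooth b)
    (b_homogeneous : forall (lambda : R) (eta : vec3 R), 0 < lambda ->
       b (lambda *: eta) = lambda `^ theta^-1 * b eta)
    (expb_L1 : leb3.-integrable [set: vec3 R] (fun eta => (expR (- b eta))%:E))
    (phiE : forall p : vec3 R,
       (phi p)%:C%C = inv_fourier3 (fun eta => expR (- b eta)) p)
    (phi_ge0 : forall p : vec3 R, 0 <= phi p)
    (J_open : open J) (J_itv : is_interval J)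
    (a_ge0 : forall m m' : R, 0 < m -> 0 < m' -> 0 <= a m m')
    (a_sym : forall m m' : R, 0 < m -> 0 < m' -> a m m' = a m' m)
    (F_solution : coagulation_solution J a F)
    (F_self_similar : coagulation_self_similar J F) :
  let f := fun (t m : R) (p : vec3 R) =>
    m `^ (- (3 * theta)) * F t m * phi ((m `^ theta)^-1 *: p) in
  ballistic_solution J a f /\ ballistic_self_similar J f.

Proof.
have b_cont : continuous b.
  by move=> x; apply: differentiable_continuous; exact: (b_smooth [::] x).
have phi_fourier (p : mvec3 R) :=
  cos_integral_inv_fourier expb_L1 (phiE p).
have phim_ge0 := momentum_density_ge0 theta phi_ge0.
have iphim := integrable_momentum_density theta_gt0 b_cont b_homogeneous
  expb_L1 phi_fourier phi_ge0.
have Iphim := Rintegral_momentum_density theta_gt0 b_cont b_homogeneous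
  expb_L1 phi_fourier phi_ge0.
have iconv := integrable_momentum_density_conv theta_gt0 b_cont b_homogeneous
  expb_L1 phi_fourier phi_ge0.
have Iconv := momentum_density_conv theta_gt0 b_cont b_homogeneous
  expb_L1 phi_fourier phi_ge0.
have mphim := measurable_momentum_density theta_gt0 b_cont b_homogeneous
  expb_L1 phi_fourier.
move=> f.
have fE t m p : f t m p = momentum_density theta phi m p * F t m.
  by rewrite /momentum_density /f mulrAC.
(* With the density abstracted to [phim], the equation follows from its nonnegativity, unit mass,
   semigroup law, integrability and measurability. *)
move: (momentum_density theta phi) phim_ge0 iphim Iphim iconv Iconv mphim fE.
move=> phim phim_ge0 iphim Iphim iconv Iconv mphim fE.
have [F_ge0 F_eq] := F_solution.
split; last first.
  have [Phi [nu [mu [numu FE]]]] := F_self_similar.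
  (* The profile is built from [Phi] as [f] is from [F]. Scaling momentum by [mu^theta] leaves
     [p / m^theta] unchanged, and [mu^(3 theta)] compensates the prefactor. *)
  exists (fun M P => M `^ (- (3 * theta)) * Phi M * phi ((M `^ theta)^-1 *: P)),
    (fun t => nu t * mu t `^ (3 * theta)), mu, (fun t => mu t `^ theta).
  split=> [t Jt|t m p Jt m0].
    by have [? ?] := numu t Jt; split; rewrite ?mulr_gt0 ?powR_gt0.
  have [nu0 mu0] := numu t Jt.
  rewrite /f FE// !powRM ?(ltW mu0) ?(ltW m0)//.
  have mun0 : mu t `^ theta != 0 by rewrite gt_eqF// powR_gt0.
  have -> : (mu t `^ theta * m `^ theta)^-1 *: (mu t `^ theta *: p) =
      (m `^ theta)^-1 *: p.
    by rewrite scalerA invfM mulrAC mulVf// mul1r.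
  rewrite (powRN (mu t)).
  have mun1 : mu t `^ (3 * theta) != 0 by rewrite gt_eqF// powR_gt0.
  by field.
split=> [t m p Jt m0|t m p Jt m0].
  by rewrite fE mulr_ge0// F_ge0.
have [iG iL dF] := F_eq t m Jt m0.
(* [G] and [L] are the coagulation integrands; [KG] and [KL] carry the momentum dependence of the
   ballistic gain and loss. *)
pose G m' := F t (m - m') * F t m' * a (m - m') m'.
pose L m' := F t m * F t m' * a m m'.
pose KG (z : mvec3 R * measurableTypeR R) :=
  phim z.2 z.1 * phim (m - z.2) (p - z.1).
pose KL (z : mvec3 R * measurableTypeR R) := phim m p * phim z.2 z.1.
have mz1 : measurable_fun setT (fun z : mvec3 R * measurableTypeR R =>
    (p - z.1, m - z.2)).
  apply: measurable_fun_pair.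
    have ms : measurable_fun setT (fun q : mvec3 R => (p : mvec3 R) - q).
      exact: measurableT_comp (@measurable_sub3 R) (pair1_measurable _).
    exact: measurableT_comp ms measurable_fst.
  by apply: measurable_funB => //; exact: measurable_snd.
have mKG : measurable_fun setT KG.
  by apply: measurable_funM => //; exact: measurableT_comp mphim mz1.
have mKL : measurable_fun setT KL by exact: measurable_funM.
have inG m' : `]0, m[%classic m' -> 0 < m' /\ 0 < m - m'.
  by rewrite /= in_itv/= subr_gt0 => /andP[].
have inL m' : `]0, +oo[%classic m' -> 0 < m'.
  by rewrite /= in_itv/= andbT.
have mG : measurable (`]0, m[%classic : set (measurableTypeR R)) by [].
have mL : measurable (`]0%R, +oo[%classic : set (measurableTypeR R)) by [].
have KG_ge0 x m' : `]0, m[%classic m' -> 0 <= KG (x, m').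
  by move=> _; rewrite mulr_ge0.
have KL_ge0 x m' : `]0, +oo[%classic m' -> 0 <= KL (x, m').
  by move=> _; rewrite mulr_ge0.
have iKG m' : `]0, m[%classic m' ->
    leb3s.-integrable setT (EFin \o (fun x => KG (x, m'))).
  by move=> /inG[m'0 mm']; exact: (iconv _ _ p m'0 mm').
have iKL m' : `]0, +oo[%classic m' ->
    leb3s.-integrable setT (EFin \o (fun x => KL (x, m'))).
  move=> /inL m'0.
  exact: (integrableZl measurableT (phim m p) (iphim _ m'0)).
(* The semigroup law with masses [m'] and [m - m'] gives the density of mass [m], independently of
   [m']. *)
have IKG m' : `]0, m[%classic m' -> \int[leb3s]_x KG (x, m') = phim m p.
  by move=> /inG[m'0 mm']; rewrite [LHS](Iconv _ _ p m'0 mm') addrC subrK.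
have IKL m' : `]0, +oo[%classic m' -> \int[leb3s]_x KL (x, m') = phim m p.
  move=> /inL m'0.
  by rewrite (RintegralZl (phim m p) measurableT (iphim _ m'0)) Iphim// mulr1.
(* The two gain terms list the arguments of [a] in opposite orders; symmetry of [a] reconciles
   them. *)
have gainE x m' : `]0, m[%classic m' ->
    a m' (m - m') * f t m' x * f t (m - m') (p - x) = G m' * KG (x, m').
  move=> /inG[m'0 mm']; rewrite !fE /G /KG/= (a_sym _ _ m'0 mm'); ring.
have lossE x m' : `]0, +oo[%classic m' ->
    a m m' * f t m p * f t m' x = L m' * KL (x, m').
  move=> /inL m'0; rewrite !fE /L /KL/=; ring.
split.
- apply: (eq_integrable _ _ _ _ (integrable_mixture mG iG mKG KG_ge0 iKG IKG)).
    exact: measurableX.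
  by move=> [x m']; rewrite inE/= => -[_ /gainE <-].
- apply: (eq_integrable _ _ _ _ (integrable_mixture mL iL mKL KL_ge0 iKL IKL)).
    exact: measurableX.
  by move=> [x m']; rewrite inE/= => -[_ /lossE <-].
(* The density does not depend on time, so both sides are the coagulation equation multiplied by
   [phim m p]. *)
rewrite (_ : (fun s => f s m p) = phim m p \*: (fun s => F s m)); last first.
  by apply/funext => s; rewrite fE.
apply: is_derive_eq.
rewrite (_ : \int[leb3]_p' _ = phim m p * \int[leb]_(m' in `]0, m[) G m');
  last first.
  rewrite -(Rintegral_mixture mG iG mKG KG_ge0 iKG IKG).
  apply: (@eq_Rintegral _ (mvec3 R) R leb3s) => x _.
  apply: eq_Rintegral => m' m'in.
  by rewrite gainE//; rewrite inE in m'in.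
rewrite [X in _ = _ - X](_ : _ =
    phim m p * \int[leb]_(m' in `]0, +oo[) L m'); last first.
  rewrite -(Rintegral_mixture mL iL mKL KL_ge0 iKL IKL).
  apply: (@eq_Rintegral _ (mvec3 R) R leb3s) => x _.
  apply: eq_Rintegral => m' m'in.
  by rewrite lossE//; rewrite inE in m'in.
rewrite /GRing.scale /=; ring.
Qed.
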